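(* For $\lambda,\mu\in X^\vee_+$, \[ \mathbf 1_0X_\lambda\mathbf 1_0T_{n^\mu}=q_\lambda\,W_\lambda(q^{-1})\sum_{\sigma\in\Gamma^d_{t^\mu,\lambda}}q_{w_0\iota(\sigma)}\,C_\sigma\,\mathbf 1_0X_{e(\sigma)} . \]
   Context: $\Phi=(X,\phi,X^\vee,\phi^\vee)$ is a reduced root datum with finite Weyl group $W$, simple roots $\alpha_1,\dots,\alpha_l$, positive roots $\phi^+$, longest element $w_0$, $X^\vee_+$ dominant coweights, $V^*=X^\vee\otimes\mathbb R$, $\mathcal C=\{x:\langle\alpha,x\rangle\ge0\ \forall\alpha\in\phi^+\}$ whose walls are the $H_{\alpha_i,0}$, where $H_{\alpha,m}=\{\langle\alpha,x\rangle=m\}$. Alcoves: closures of components of $V^*\setminus\bigcup H_{\alpha,m}$; $A_f=\{0\le\langle\alpha,x\rangle\le1\}$. $\tilde W^a=W\ltimes X^\vee$ ($\tau_\mu$ translations), $W^a=W\ltimes Q^\vee$ Coxeter group with generators $S^a$ (reflections in walls of $A_f$), $\Omega$ stabilizer of $A_f$, $\tilde W^a=\Omega\ltimes W^a$, $l(wg)=l(w)$. Generalized alcoves $\tilde{\mathcal A}=\{(A,\mu):\mu\in A\cap X^\vee\}$, $A_v=v\cdot(A_f,0)$, right action $A_vu=A_{vu}$, each uniquely $\mu+A_w$ ($w\in W$), $wt=\mu$, $\delta=w$. For $s\in S^a$ the alcoves of $A,As$ share a face in a separating hyperplane $H_{\alpha,m}$ ($\alpha\in\phi^+$); $A\prec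 As$ if the alcove of $A$ lies in $\{\langle\alpha,x\rangle\le m\}$, else $A\succ As$. $W_\lambda$ = stabilizer of $\lambda$ in $W$; $n^\mu$ = minimal length element of $\tau_\mu W$. Galleries: type $t=(t_1,\dots,t_k)$, $t_i\in S^a\cup\Omega$; gallery $(A_0,\dots,A_k)$ with $A_{i+1}=A_it_{i+1}$ if $t_{i+1}\in\Omega$, $A_{i+1}\in\{A_i,A_it_{i+1}\}$ otherwise; $\iota(\sigma)=\delta(A_0)$, $e(\sigma)=A_k$. Positive $s$-direction at $i$: $t_{i+1}=s$, $A_{i+1}=A_is$, $A_i\prec A_is$. $s$-fold at $i$: $t_{i+1}=s$, $A_{i+1}=A_i$, folding hyperplane = separating hyperplane of $A_i,A_is$, positive if $A_i\succ A_is$. Positively folded = all folds positive; minimal = shortest between endpoints. $t^\mu$ = type of a minimal gallery from $A_f$ to $A_{n^\mu}$. $\Gamma^d_{t,\lambda}$ = positively folded galleries of type $t$ with $wt(A_0)=\lambda$ all of whose alcoves lie in $\mathcal C$. Parameters: $d:S^a\to\mathbb N$ invariant under $\tilde W^a$-conjugation, $\mathcal L=\mathbb Z[q^{\pm1/2}]$, $q_s=q^{d(s)}$, $q_v=\prod q_{t_j}$ for reduced $v=t_1\cdots t_kg$; $W_\lambda(q^{-1})=\sum_{w\in W_\lambda}q_w^{-1}$; $q_\lambda=q_{\tau_\lambda}^{1/2}$ for dominant $\lambda$, $q_{\lambda-\lambda'}=q_\lambda/q_{\lambda'}$. $C_\sigma=\prod_sq_s^{m_s+p_s}(q_s-1)^{r_s}$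 where $m_s$ = number of positive $s$-directions, $p_s$ = number of $s$-folds whose folding hyperplane is a wall of $\mathcal C$, $r_s$ = number of the other $s$-folds. Hecke algebra $\tilde{\mathcal H}$: $\mathcal L$-basis $T_w$, $T_s^2=q_sT_{id}+(q_s-1)T_s$, $T_vT_w=T_{vw}$ if lengths add; $\overline T_w=T_{w^{-1}}^{-1}$; $X_{\lambda-\lambda'}=q_{\lambda-\lambda'}^{-1}T_{\tau_\lambda}T_{\tau_{\lambda'}}^{-1}$; $X_A=q_{-wt(A)}q_{\delta(A)}X_{wt(A)}\overline T_{\delta(A)}$; $\mathbf 1_0=\sum_{w\in W}T_w$. *)

(* Defs.v *)
From HB Require Import structures.
From mathcomp Require Import all_boot all_order all_algebra fraction.
From mathcomp Require Import finmap.
From mathcomp Require Import all_classical all_reals topology.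

Set Implicit Arguments.
Unset Strict Implicit.
Unset Printing Implicit Defensive.

Import Order.TTheory GRing.Theory Num.Theory numFieldTopology.Exports.

Local Open Scope classical_set_scope.
Local Open Scope ring_scope.

(* Z[q^{1/2}, q^{-1/2}] is the subring of the field of fractions of Z['X] formed by the p / 'X^k,
    where 'X stands for q^{1/2}. *)

Definition laurent_pred : {pred {fraction {poly int}}} :=
  fun f => `[< exists (p : {poly int}) (k : nat),
                 f * (tofrac 'X) ^+ k = tofrac p >].

Fact laurent_subring : subring_closed laurent_pred.
Proof.
split.
- by apply/asboolP; exists 1, 0%N; rewrite expr0 mulr1 rmorph1.
- move=> f g /asboolP[p [k fE]] /asboolP[r [l gE]]; apply/asboolP.
  exists (p * 'X^l - r * 'X^k), (k + l)%N.
  rewrite tofracB !tofracM !tofracXn -fE -gE mulrBl exprD.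
  by congr (_ - _); rewrite mulrA // mulrAC.
- move=> f g /asboolP[p [k fE]] /asboolP[r [l gE]]; apply/asboolP.
  exists (p * r), (k + l)%N.
  by rewrite tofracM -fE -gE exprD mulrACA.
Qed.

HB.instance Definition _ :=
  GRing.isSubringClosed.Build {fraction {poly int}} laurent_pred laurent_subring.

Record laurent := Laurent {
  laurent_val : {fraction {poly int}};
  _ : laurent_val \in laurent_pred
}.

HB.instance Definition _ := [isSub for laurent_val].
HB.instance Definition _ := [Choice of laurent by <:].
HB.instance Definition _ := [SubChoice_isSubComNzRing of laurent by <:].

Definition laurent_unit : {pred laurent} :=
  fun x => `[< exists y : laurent, y * x = 1 >].
Definition laurent_inv (x : laurent) : laurent :=
  if x \in laurent_unit then xget 0 [set y | y * x = 1] else x.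

Fact laurent_mulVx : {in laurent_unit, left_inverse 1 laurent_inv *%R}.
Proof.
move=> x ux; rewrite /laurent_inv ux; move/asboolP: ux => [y yx].
by case: xgetP => [z _ //|/(_ y)]; case.
Qed.

Fact laurent_unitPl (x y : laurent) : y * x = 1 -> x \in laurent_unit.
Proof. by move=> yx; apply/asboolP; exists y. Qed.

Fact laurent_invr_out : {in [predC laurent_unit], laurent_inv =1 id}.
Proof. by move=> x; rewrite inE /laurent_inv => /negbTE->. Qed.

HB.instance Definition _ := GRing.ComNzRing_hasMulInverse.Build laurent
  laurent_mulVx laurent_unitPl laurent_invr_out.

Fact qhalf_subproof : tofrac 'X \in laurent_pred.
Proof. by apply/asboolP; exists 'X, 0%N; rewrite expr0 mulr1. Qed.

(* [qhalf] is q^{1/2}. *)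
Definition qhalf : laurent := Laurent qhalf_subproof.
Definition q : laurent := qhalf ^+ 2.

Lemma qhalf_unit : qhalf \is a GRing.unit.
Proof.
have X0 : tofrac ('X : {poly int}) != 0 by rewrite tofrac_eq0 polyX_eq0.
have i : (tofrac ('X : {poly int}))^-1 \in laurent_pred.
  by apply/asboolP; exists 1, 1%N; rewrite expr1 mulVf // rmorph1.
by apply/(@laurent_unitPl _ (Laurent i))/val_inj; rewrite /= mulVf.
Qed.

(* X and X^v are free of finite rank n and in perfect duality; in dual bases
    X consists of row vectors, X^v of column vectors, and the pairing is the
    matrix product. *)

Definition pairZ n (a : 'rV[int]_n) (x : 'cV[int]_n) : int := (a *m x) 0 0.

(* A reduced root datum together with a choice of simple roots. The function
   [coroot] is only meaningful on [roots]; phi^v is the image of [roots]. *)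
Record rootDatum (n : nat) := RootDatum {
  roots : {fset 'rV[int]_n};
  coroot : 'rV[int]_n -> 'cV[int]_n;
  coroot_inj : {in roots &, injective coroot};
  pair_coroot : forall a, a \in roots -> pairZ a (coroot a) = 2;
  roots_stable : forall a b, a \in roots -> b \in roots ->
    b - pairZ b (coroot a) *: a \in roots;
  coroots_stable : forall a b, a \in roots -> b \in roots ->
    exists2 c, c \in roots &
      coroot b - pairZ a (coroot b) *: coroot a = coroot c;
  roots_reduced : forall a b, a \in roots -> b \in roots ->
    (exists k l : int, k != 0 /\ k *: b = l *: a) -> b = a \/ b = - a;
  ssrank : nat;
  simple : 'I_ssrank -> 'rV[int]_n;
  simple_root : forall i, simple i \in roots;
  simple_free : forall c : 'I_ssrank -> int,
    \sum_i c i *: simple i = 0 -> forall i, c i = 0;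
  simple_sign : forall a, a \in roots ->
    exists c : 'I_ssrank -> nat,
      a = \sum_i simple i *+ c i \/ a = - \sum_i simple i *+ c i
}.

Arguments simple {n} r i.

Section Weyl.
Variables (n : nat) (D : rootDatum n).

Definition posroot (a : 'rV[int]_n) : Prop :=
  a \in roots D /\ exists c : 'I_(ssrank D) -> nat,
    a = \sum_i simple D i *+ c i.

(* X^v_+ *)
Definition dominant (x : 'cV[int]_n) : Prop :=
  forall a, posroot a -> 0 <= pairZ a x.

(* x |-> x - <a, x> a^v on X^v *)
Definition refl (a : 'rV[int]_n) : 'M[int]_n := 1%:M - coroot D a *m a.

Definition weylmx : set 'M[int]_n :=
  [set M | exists2 s : seq 'rV[int]_n, {subset s <= roots D} &
           M = \prod_(a <- s) refl a].

Lemma weylmx1 : weylmx 1%:M.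
Proof. by exists [::]; rewrite ?big_nil. Qed.

Lemma weylmxM M N : weylmx M -> weylmx N -> weylmx (M *m N).
Proof.
move=> [s sR ->] [t tR ->]; exists (s ++ t); last by rewrite big_cat.
by move=> a; rewrite mem_cat => /orP[/sR|/tR].
Qed.

Lemma refl_invol a : a \in roots D -> refl a *m refl a = 1%:M.
Proof.
move=> aR; rewrite /refl mulmxBl mul1mx mulmxBr mulmx1.
rewrite mulmxA -(mulmxA _ a) (mx11_scalar (a *m coroot D a)).
have := pair_coroot aR; rewrite /pairZ => ->.
rewrite mul_mx_scalar -scalemxAl (_ : 2 = 1 + 1) // scalerDl scale1r.
by rewrite opprB addrK subrK.
Qed.

Lemma weylmx_inv M : weylmx M -> M \in unitmx /\ weylmx (invmx M).
Proof.
move=> [s]; elim: s M => [|a s IHs] M sR ->.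
  by rewrite big_nil unitmx1 invmx1; split=> //; exact: weylmx1.
have aR : a \in roots D by apply: sR; rewrite mem_head.
have /(IHs _)[|ut wt] // := erefl (\prod_(b <- s) refl b).
  by move=> b bs; apply: sR; rewrite inE bs orbT.
have ua : refl a \in unitmx by have [] := mulmx1_unit (refl_invol aR).
rewrite big_cons unitmx_mul ua ut; split=> //.
set N := \big[_/_]_(b <- s) _ in ut wt *.
have -> : invmx (refl a *m N) = invmx N *m refl a.
  have u : refl a *m N \in unitmx by rewrite unitmx_mul ua ut.
  apply: (can_inj (mulKmx u)); rewrite mulmxV //.
  by rewrite mulmxA -(mulmxA _ N) mulmxV // mulmx1 refl_invol.
apply: weylmxM => //; exists [:: a]; last by rewrite big_seq1.
by move=> b; rewrite inE => /eqP->.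
Qed.

(* W |x X^v: the pair (x, M) is the affine transformation y |-> x + M y, that
   is, tau_x M. *)
Definition wext : Type := {v : 'cV[int]_n * 'M[int]_n | v.2 \in weylmx}.

HB.instance Definition _ := Choice.on wext.

Definition mkwext (x : 'cV[int]_n) (M : 'M[int]_n) (h : weylmx M) : wext :=
  exist (fun v : 'cV[int]_n * 'M[int]_n => v.2 \in weylmx) (x, M) (mem_set h).

Lemma wextP (v : wext) : weylmx (val v).2.
Proof. exact: set_mem (valP v). Qed.

Definition wext_one : wext := mkwext 0 weylmx1.
Definition wext_mul (v w : wext) : wext :=
  mkwext ((val v).1 + (val v).2 *m (val w).1) (weylmxM (wextP v) (wextP w)).
Definition wext_inv (v : wext) : wext :=
  mkwext (- (invmx (val v).2 *m (val v).1)) (weylmx_inv (wextP v)).2.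

Fact wext_mulA : associative wext_mul.
Proof.
by move=> u v w; apply/val_inj; rewrite /= mulmxDr !mulmxA addrA.
Qed.

Fact wext_mul1 : left_id wext_one wext_mul.
Proof.
by move=> [[x M] h]; apply/val_inj; rewrite /= !mul1mx add0r.
Qed.

Fact wext_mulr1 : right_id wext_one wext_mul.
Proof.
by move=> [[x M] h]; apply/val_inj; rewrite /= mulmx0 addr0 mulmx1.
Qed.

Fact wext_mulV : left_inverse wext_one wext_inv wext_mul.
Proof.
move=> [[x M] h]; apply/val_inj; have [u _] := weylmx_inv (set_mem h).
by rewrite /= mulVmx // addNr.
Qed.

Fact wext_mulrV : right_inverse wext_one wext_inv wext_mul.
Proof.
move=> [[x M] h]; apply/val_inj; have [u _] := weylmx_inv (set_mem h).
by rewrite /= mulmxN mulmxA mulmxV // mul1mx subrr.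
Qed.

HB.instance Definition _ := isGroup.Build wext
  wext_mulA wext_mul1 wext_mulr1 wext_mulV wext_mulrV.

(* tau_x *)
Definition transl (x : 'cV[int]_n) : wext := mkwext x weylmx1.

(* W as a subgroup of [wext] *)
Definition weyl : set wext := [set v | (val v).1 = 0].

Definition actZ (v : wext) (x : 'cV[int]_n) : 'cV[int]_n :=
  (val v).1 + (val v).2 *m x.

(* W_x *)
Definition stab (x : 'cV[int]_n) : set wext :=
  [set w | weyl w /\ actZ w x = x].

End Weyl.

Arguments weyl {n} D.
Arguments stab {n} D x.

Section Alcoves.
Variables (R : realType) (n : nat) (D : rootDatum n).

(* V^* = X^v (x) R *)
Local Notation V := 'cV[R]_n.
Local Notation W := (wext D).

Definition pairR (a : 'rV[int]_n) (x : V) : R :=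
  (map_mx intr a *m x) 0 0.

Definition hyp (a : 'rV[int]_n) (m : int) : set V :=
  [set x | pairR a x = m%:~R].

Definition hyperplane (h : set V) : Prop :=
  exists a m, a \in roots D /\ h = hyp a m.

Definition chamber : set V :=
  [set x | forall a, posroot D a -> 0 <= pairR a x].

Definition chamber_wall (h : set V) : Prop :=
  exists i, h = hyp (simple D i) 0.

Definition regular : set V := [set x | forall h, hyperplane h -> ~ h x].

Definition alcove (A : set V) : Prop :=
  exists2 x, regular x & A = closure (connected_component regular x).

(* A_f *)
Definition fund_alcove : set V :=
  [set x | forall a, posroot D a -> 0 <= pairR a x <= 1].

(* A wall of A is the support of a codimension one face of A, i.e. a hyperplane
   which is the only one passing through some point of A. *)
Definition wall (A h : set V) : Prop :=
  hyperplane h /\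
  exists2 x, A x /\ h x & forall h', hyperplane h' -> h' x -> h' = h.

Definition act (v : W) (x : V) : V :=
  map_mx intr (val v).1 + map_mx intr (val v).2 *m x.

(* S^a: y |-> y - (<a, y> - m) a^v is the reflection in H_{a,m}. *)
Definition Sa : set W :=
  [set v | exists a m, [/\ a \in roots D, wall fund_alcove (hyp a m) &
             val v = (m *: coroot D a, refl D a)]].

Definition Omega : set W := [set v | act v @` fund_alcove = fund_alcove].

Definition word (v : W) (ts : seq W) : Prop :=
  (forall s, s \in ts -> Sa s) /\
  exists2 g, Omega g & v = ((\prod_(s <- ts) s) * g)%g.

Definition reduced_word (v : W) (ts : seq W) : Prop :=
  word v ts /\ forall ts', word v ts' -> (size ts <= size ts')%N.

Definition redword (v : W) : seq W := xget [::] (reduced_word v).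

Definition len (v : W) : nat := size (redword v).

Definition longest (w0 : W) : Prop :=
  weyl D w0 /\ forall w, weyl D w -> (len w <= len w0)%N.

(* n^x *)
Definition min_rep (x : 'cV[int]_n) (v : W) : Prop :=
  let coset := [set (transl D x * w)%g | w in weyl D] in
  coset v /\ forall v', coset v' -> (len v <= len v')%N.

Definition galc : Type := (set V * 'cV[int]_n)%type.

Definition galcoves : set galc :=
  [set A | alcove A.1 /\ A.1 (map_mx intr A.2)].

(* A_v = v . (A_f, 0) *)
Definition galc_of (v : W) : galc := (act v @` fund_alcove, actZ v 0).

Definition wt (A : galc) : 'cV[int]_n := A.2.

Definition delta (A : galc) : W :=
  xget 1%g [set w | weyl D w /\ A = galc_of (transl D (wt A) * w)%g].

(* A = wt A + A_w with w = delta A is A_v for v = tau_{wt A} w; A_v u = A_{vu} *)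
Definition ract (A : galc) (u : W) : galc :=
  galc_of (transl D (wt A) * delta A * u)%g.

Definition halfspace_le (a : 'rV[int]_n) (m : int) : set V :=
  [set x | pairR a x <= m%:~R].
Definition halfspace_ge (a : 'rV[int]_n) (m : int) : set V :=
  [set x | m%:~R <= pairR a x].

Definition separating (A B : galc) (a : 'rV[int]_n) (m : int) : Prop :=
  posroot D a /\
  (A.1 `<=` halfspace_le a m /\ B.1 `<=` halfspace_ge a m \/
   A.1 `<=` halfspace_ge a m /\ B.1 `<=` halfspace_le a m).

(* A precedes As, for s in S^a *)
Definition prec (A : galc) (s : W) : Prop :=
  exists a m, separating A (ract A s) a m /\ A.1 `<=` halfspace_le a m.
Definition succ (A : galc) (s : W) : Prop := ~ prec A s.

Definition gtype (t : seq W) : Prop := forall u, u \in t -> Sa u \/ Omega u.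

(* [ith sigma i] is A_i; the letter t_{i+1} of a type is [nth 1%g t i]. *)
Definition ith (sigma : seq galc) (i : nat) : galc := nth (galc_of 1%g) sigma i.

Definition gallery (t : seq W) (sigma : seq galc) : Prop :=
  [/\ size sigma = (size t).+1,
      forall A, A \in sigma -> galcoves A &
      forall i, (i < size t)%N ->
        let u := nth 1%g t i in
        (Omega u -> ith sigma i.+1 = ract (ith sigma i) u) /\
        (Sa u -> ith sigma i.+1 = ith sigma i \/
                 ith sigma i.+1 = ract (ith sigma i) u)].

Definition initial_dir (sigma : seq galc) : W := delta (ith sigma 0).
Definition end_ (sigma : seq galc) : galc := ith sigma (size sigma).-1.

Definition pos_direction (t : seq W) (sigma : seq galc) (s : W) (i : nat) :=
  [/\ nth 1%g t i = s, ith sigma i.+1 = ract (ith sigma i) s &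
      prec (ith sigma i) s].

Definition fold (t : seq W) (sigma : seq galc) (s : W) (i : nat) :=
  nth 1%g t i = s /\ ith sigma i.+1 = ith sigma i.

Definition positively_folded (t : seq W) (sigma : seq galc) : Prop :=
  forall i s, (i < size t)%N -> Sa s -> fold t sigma s i ->
    succ (ith sigma i) s.

Definition chamber_fold (t : seq W) (sigma : seq galc) (s : W) (i : nat) :=
  fold t sigma s i /\
  exists a m, separating (ith sigma i) (ract (ith sigma i) s) a m /\
              chamber_wall (hyp a m).

Definition other_fold (t : seq W) (sigma : seq galc) (s : W) (i : nat) :=
  fold t sigma s i /\ ~ chamber_fold t sigma s i.

Definition minimal_gallery (t : seq W) (sigma : seq galc) : Prop :=
  gtype t /\ gallery t sigma /\
  forall t' sigma', gtype t' -> gallery t' sigma' ->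
    ith sigma' 0 = ith sigma 0 -> end_ sigma' = end_ sigma ->
    (size t <= size t')%N.

Definition minimal_type (v : W) (t : seq W) : Prop :=
  exists sigma, [/\ minimal_gallery t sigma,
    ith sigma 0 = galc_of 1%g & end_ sigma = galc_of v].

(* Gamma^d_{t, x} *)
Definition Gamma_d (t : seq W) (x : 'cV[int]_n) : set (seq galc) :=
  [set sigma | [/\ gallery t sigma, positively_folded t sigma,
     wt (ith sigma 0) = x &
     forall A, A \in sigma -> A.1 `<=` chamber]].

Definition npos (t : seq W) (P : nat -> Prop) : nat :=
  #|[pred i : 'I_(size t) | `[< P i >]]|.

(* Only the values of d on S^a are relevant. *)
Definition conj_invariant (d : W -> nat) : Prop :=
  forall v s s', Sa s -> Sa s' -> s' = (v * s * v^-1)%g -> d s' = d s.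

Variable d : W -> nat.

Definition qs (s : W) : laurent := q ^+ d s.

Definition qw (v : W) : laurent := \prod_(s <- redword v) qs s.

(* q_{tau_x}^{1/2} *)
Definition qdom (x : 'cV[int]_n) : laurent :=
  \prod_(s <- redword (transl D x)) qhalf ^+ d s.

(* Some dominant l, l' with x = l - l' *)
Definition dom_split (x : 'cV[int]_n) : 'cV[int]_n * 'cV[int]_n :=
  xget (x, 0) [set p | [/\ dominant D p.1, dominant D p.2 & x = p.1 - p.2]].

(* q_x for arbitrary x in X^v *)
Definition qwt (x : 'cV[int]_n) : laurent :=
  qdom (dom_split x).1 / qdom (dom_split x).2.

(* W_x(q^-1) *)
Definition stab_poly (x : 'cV[int]_n) : laurent :=
  \sum_(w \in stab D x) (qw w)^-1.

Definition Cgal (t : seq W) (sigma : seq galc) : laurent :=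
  \big[*%R/1]_(s \in Sa)
    (qs s ^+ (npos t (pos_direction t sigma s) +
              npos t (chamber_fold t sigma s))
     * (qs s - 1) ^+ npos t (other_fold t sigma s)).

(* The relations determine the algebra up to a unique isomorphism. The units
   needed below are the T_w, so that a [unitAlgType] gives access to their
   inverses. *)
Record heckeAlgebra := HeckeAlgebra {
  hecke_car :> unitAlgType laurent;
  T : W -> hecke_car;
  T_span : forall h : hecke_car, exists (c : W -> laurent) (r : seq W),
    h = \sum_(w <- r) c w *: T w;
  T_free : forall (c : W -> laurent) (r : seq W), uniq r ->
    \sum_(w <- r) c w *: T w = 0 -> forall w, w \in r -> c w = 0;
  T_quad : forall s, Sa s -> T s * T s = qs s *: T 1%g + (qs s - 1) *: T s;
  T_mul : forall v w, len (v * w)%g = (len v + len w)%N ->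
    T v * T w = T (v * w)%g
}.

Variable H : heckeAlgebra.

Definition Tbar (w : W) : H := (T H w^-1%g)^-1.

Definition Xwt (x : 'cV[int]_n) : H :=
  (qwt x)^-1 *: (T H (transl D (dom_split x).1)
                 * (T H (transl D (dom_split x).2))^-1).

Definition Xgalc (A : galc) : H :=
  (qwt (- wt A) * qw (delta A)) *: (Xwt (wt A) * Tbar (delta A)).

Definition one0 : H := \sum_(w \in weyl D) T H w.

End Alcoves.

Arguments Gamma_d {R n} D t x.

(* Main.v *)
(* Each alcove v . A_f is recorded by the integers k with k < a < k + 1 on its
   interior, a running over the positive roots. Right multiplication by s in S^a
   changes exactly one of them, by one, so l(v) is the number of hyperplanes
   separating A_f and v . A_f, and q_v multiplies over these hyperplanes.
   If A = A_v lies in the dominant chamber, with v = tau_x w, then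
   l(tau_x) = l(v) + l(w), so that X_A = q_v^-1 T_v: no Bernstein relation is
   needed. For such A, multiplying one0 X_A by T_s gives one of
   - q_s one0 X_{As} if A precedes As,
   - one0 X_{As} + (q_s - 1) one0 X_A if A succeeds As and As is dominant,
   - q_s one0 X_A if As is not dominant: then vs = s_i v for a simple reflection
     s_i conjugate to s, and T_v T_s = T_{s_i} T_v.
   Iterating along t sums over the dominant positively folded galleries from A.
   The starting alcoves come from one0 = q_{w0} sum_w Tbar_w and the length
   additive factorization of w into an element of W_lambda and a w' such that
   lambda + A_{w'} is dominant; the first factor contributes W_lambda(q^-1). *)

Require Import Defs.
From HB Require Import structures.
From mathcomp Require Import all_boot all_order all_algebra finmap.
From mathcomp Require Import all_classical all_reals topology normedtype.
From mathcomp Require Import zify ring lra.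

Set Implicit Arguments.
Unset Strict Implicit.
Unset Printing Implicit Defensive.

Import Order.TTheory GRing.Theory Num.Theory.
Import numFieldTopology.Exports numFieldNormedType.Exports.

Local Open Scope classical_set_scope.
Local Open Scope ring_scope.

(** * Root data *)

(** The definitions speak of closures of components, walls and sets of galleries, while the Hecke
    relations only see lengths; floors are the bridge, since separation, $\prec$ and dominance of
    A_v become inequalities between integers. Two geometric facts carry this. A wall of A_f contains
    a point on no other hyperplane, and its image under v lies in both A_v and A_{vs}, so only one
    floor can change. Conversely A_f is cut out by its walls: if v does not preserve A_f, some wall
    of A_v separates it from A_f, and crossing it shortens v. This produces words whose size is the
    number of separating hyperplanes, and so identifies [len]. The word behind q_v is an arbitrary
    choice; invariance of d under conjugation turns the sum of d along it into a sum of weights of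
    hyperplanes, which depends on v alone. On the side of galleries the difficulty is that [Gamma_d]
    is a set of sequences of arbitrary generalized alcoves: each of these is some A_v, and the
    galleries from a given A_v are enumerated by recursion on the type, in step with the
    multiplications by T_s. *)

Section Pairing.
Variable n : nat.
Implicit Types (a b : 'rV[int]_n) (x y : 'cV[int]_n) (M : 'M[int]_n).

Lemma pairZDl a b x : pairZ (a + b) x = pairZ a x + pairZ b x.
Proof. by rewrite /pairZ mulmxDl mxE. Qed.

Lemma pairZDr a x y : pairZ a (x + y) = pairZ a x + pairZ a y.
Proof. by rewrite /pairZ mulmxDr mxE. Qed.

Lemma pairZNl a x : pairZ (- a) x = - pairZ a x.
Proof. by rewrite /pairZ mulNmx mxE. Qed.

Lemma pairZNr a x : pairZ a (- x) = - pairZ a x.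
Proof. by rewrite /pairZ mulmxN mxE. Qed.

Lemma pairZBl a b x : pairZ (a - b) x = pairZ a x - pairZ b x.
Proof. by rewrite pairZDl pairZNl. Qed.

Lemma pairZBr a x y : pairZ a (x - y) = pairZ a x - pairZ a y.
Proof. by rewrite pairZDr pairZNr. Qed.

Lemma pairZZl k a x : pairZ (k *: a) x = k * pairZ a x.
Proof. by rewrite /pairZ -scalemxAl mxE. Qed.

Lemma pairZZr k a x : pairZ a (k *: x) = k * pairZ a x.
Proof. by rewrite /pairZ -scalemxAr mxE. Qed.

Lemma pairZ0l x : pairZ 0 x = 0.
Proof. by rewrite /pairZ mul0mx mxE. Qed.

Lemma pairZ0r a : pairZ a 0 = 0.
Proof. by rewrite /pairZ mulmx0 mxE. Qed.

Lemma pairZ_suml (I : Type) (r : seq I) (P : pred I) F x :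
  pairZ (\sum_(i <- r | P i) F i) x = \sum_(i <- r | P i) pairZ (F i) x.
Proof.
exact: (big_morph (fun a => pairZ a x) (fun a b => pairZDl a b x) (pairZ0l x)).
Qed.

Lemma pairZMnl a k x : pairZ (a *+ k) x = pairZ a x *+ k.
Proof. by elim: k => [|k IHk]; rewrite ?pairZ0l // !mulrS pairZDl IHk. Qed.

Lemma pairZ_mulmx a M x : pairZ (a *m M) x = pairZ a (M *m x).
Proof. by rewrite /pairZ mulmxA. Qed.

Lemma pairZ_inj a b : (forall x, pairZ a x = pairZ b x) -> a = b.
Proof.
move=> ab; apply/rowP => i; have := ab (delta_mx i 0).
by rewrite /pairZ -!colE !mxE.
Qed.

End Pairing.

(** * Reflections, coroots and an invariant form *)

Section Roots.
Variables (n : nat) (D : rootDatum n).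
Implicit Types (a b e : 'rV[int]_n) (x y : 'cV[int]_n) (M N : 'M[int]_n).
Local Notation Phi := (Defs.roots D).
Local Notation s_ := (Defs.refl D).

Lemma mulmx_refl a b : a *m s_ b = a - pairZ a (coroot D b) *: b.
Proof.
rewrite /Defs.refl mulmxBr mulmx1 mulmxA (mx11_scalar (a *m coroot D b)).
by rewrite mul_scalar_mx.
Qed.

Lemma refl_mulmx a x : s_ a *m x = x - pairZ a x *: coroot D a.
Proof.
rewrite /Defs.refl mulmxBl mul1mx -mulmxA (mx11_scalar (a *m x)).
by rewrite mul_mx_scalar.
Qed.

Lemma mulmx_refl_id a : a \in Phi -> a *m s_ a = - a.
Proof.
move=> aR; rewrite mulmx_refl pair_coroot // (_ : 2 = 1 + 1) //.
by rewrite scalerDl scale1r opprD addrA subrr add0r.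
Qed.

Lemma refl_weylmx a : a \in Phi -> weylmx D (s_ a).
Proof.
by move=> aR; exists [:: a]; rewrite ?big_seq1 // => b; rewrite inE => /eqP->.
Qed.

Lemma root_mul_weyl a M : weylmx D M -> a \in Phi -> a *m M \in Phi.
Proof.
move=> [s + ->]; elim: s a => [|b s IHs] a sR aR; first by rewrite big_nil mulmx1.
rewrite big_cons mulmxA; apply: IHs => [c cs|].
  by apply: sR; rewrite inE cs orbT.
by rewrite mulmx_refl; apply: roots_stable => //; apply: sR; rewrite mem_head.
Qed.

Lemma root_opp a : a \in Phi -> - a \in Phi.
Proof.
by move=> aR; rewrite -mulmx_refl_id //; apply: root_mul_weyl (refl_weylmx aR) aR.
Qed.

Lemma root_neq0 a : a \in Phi -> a != 0.
Proof.
by move=> aR; apply/eqP => a0; have := pair_coroot aR; rewrite a0 pairZ0l.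
Qed.

Lemma weyl_mul_inj M : weylmx D M -> injective (fun a : 'rV[int]_n => a *m M).
Proof. by move=> /weylmx_inv[u _]; apply: (can_inj (mulmxK u)). Qed.

Lemma roots_perm M : weylmx D M -> perm_eq [seq a *m M | a <- Phi] Phi.
Proof.
move=> wM; have [u wi] := weylmx_inv wM.
apply: uniq_perm; [rewrite (map_inj_uniq (weyl_mul_inj wM)); exact: fset_uniq|exact: fset_uniq|].
move=> a; apply/mapP/idP => [[b bR ->]|aR]; first exact: root_mul_weyl.
by exists (a *m invmx M); [apply: root_mul_weyl | rewrite mulmxKV].
Qed.

(** The canonical W-invariant form on X^v. It may be degenerate, but it is positive on each coroot,
    where the root itself contributes 4. *)
Definition rform x y : int := \sum_(e <- Phi) pairZ e x * pairZ e y.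

Lemma rformC x y : rform x y = rform y x.
Proof. by apply: eq_bigr => e _; rewrite mulrC. Qed.

Lemma rformBr x y z : rform x (y - z) = rform x y - rform x z.
Proof.
by rewrite -sumrB; apply: eq_bigr => e _; rewrite pairZBr mulrBr.
Qed.

Lemma rformNr x y : rform x (- y) = - rform x y.
Proof.
by rewrite -sumrN; apply: eq_bigr => e _; rewrite pairZNr mulrN.
Qed.

Lemma rformZr x k y : rform x (k *: y) = k * rform x y.
Proof.
by rewrite mulr_sumr; apply: eq_bigr => e _; rewrite pairZZr mulrCA.
Qed.

Lemma rform_weyl M x y : weylmx D M -> rform (M *m x) (M *m y) = rform x y.
Proof.
move=> wM; rewrite {2}/rform -(perm_big _ (roots_perm wM)) /= big_map.
by apply: eq_bigr => e _; rewrite !pairZ_mulmx.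
Qed.

Lemma rform_coroot_gt0 a : a \in Phi -> 0 < rform (coroot D a) (coroot D a).
Proof.
move=> aR; rewrite /rform (big_fsetD1 a) //= pair_coroot // ltr_wpDr //.
by apply: sumr_ge0 => e _; rewrite -expr2 sqr_ge0.
Qed.

(** The reflection s_a preserves the form and negates the coroot of a; expanding the form at s_a x
    gives the identity. *)
Lemma rform_coroot a x : a \in Phi ->
  2 * rform x (coroot D a) = pairZ a x * rform (coroot D a) (coroot D a).
Proof.
move=> aR; have := rform_weyl x (coroot D a) (refl_weylmx aR).
have -> : s_ a *m coroot D a = - coroot D a.
  rewrite refl_mulmx pair_coroot // (_ : 2 = 1 + 1) //.
  by rewrite scalerDl scale1r opprD addrA subrr add0r.
rewrite refl_mulmx rformNr rformC rformBr rformZr [rform _ x]rformC; lia.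
Qed.

(* The functional [rform _ (coroot c)] is a positive multiple of c, which
   recovers the root c from its coroot. *)
Lemma coroot_refl a b : a \in Phi -> b \in Phi ->
  coroot D (a *m s_ b) = s_ b *m coroot D a.
Proof.
move=> aR bR; have [c cR cE] := coroots_stable bR aR.
rewrite refl_mulmx cE; congr (coroot D).
have aR' := root_mul_weyl (refl_weylmx bR) aR.
set Nc := rform (coroot D c) (coroot D c); set Na := rform (coroot D a) (coroot D a).
have Nc0 : 0 < Nc by apply: rform_coroot_gt0.
have Na0 : 0 < Na by apply: rform_coroot_gt0.
have E : Nc *: c = Na *: (a *m s_ b).
  apply: pairZ_inj => x; rewrite !pairZZl mulrC -rform_coroot // pairZ_mulmx.
  rewrite [RHS]mulrC -rform_coroot // -cE -refl_mulmx; congr (_ * _).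
  rewrite -(rform_weyl _ _ (refl_weylmx bR)) mulmxA refl_invol // mul1mx //.
have : c = a *m s_ b \/ c = - (a *m s_ b).
  by apply: (roots_reduced aR' cR); exists Nc, Na; split=> //; rewrite gt_eqF.
case=> // cN; move: E; rewrite cN scalerN => /eqP; rewrite eq_sym -subr_eq0 opprK.
by rewrite -scalerDl scalemx_eq0 (negPf (root_neq0 aR')) orbF gt_eqF // addr_gt0.
Qed.

(** Roots are rows acted on from the right, so a M is the root M^-1 a in the usual notation, and its
    coroot is M^-1 applied to that of a. *)
Lemma coroot_weyl M a : weylmx D M -> a \in Phi -> M *m coroot D (a *m M) = coroot D a.
Proof.
move=> [s + ->]; elim: s a => [|b s IHs] a sR aR.
  by rewrite big_nil mul1mx mulmx1.
have bR : b \in Phi by apply: sR; rewrite mem_head.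
rewrite big_cons -[_ * _]/(_ *m _) (mulmxA a) -mulmxA IHs;
  last exact: root_mul_weyl (refl_weylmx bR) aR.
  by rewrite coroot_refl // mulmxA refl_invol // mul1mx.
by move=> c cs; apply: sR; rewrite inE cs orbT.
Qed.

Lemma refl_conj M a : weylmx D M -> a \in Phi -> M *m s_ (a *m M) = s_ a *m M.
Proof.
move=> wM aR; rewrite /Defs.refl mulmxBr mulmxBl mulmx1 mul1mx !mulmxA.
by rewrite coroot_weyl.
Qed.

Lemma corootN a : a \in Phi -> coroot D (- a) = - coroot D a.
Proof.
move=> aR; rewrite -{1}mulmx_refl_id // coroot_refl // refl_mulmx pair_coroot //.
by rewrite (_ : 2 = 1 + 1) // scalerDl scale1r opprD addrA subrr add0r.
Qed.

Lemma reflN a : a \in Phi -> s_ (- a) = s_ a.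
Proof. by move=> aR; rewrite /Defs.refl corootN // mulNmx mulmxN opprK. Qed.

End Roots.

(** * Positive roots and the Weyl group *)

Section Positive.
Variables (n : nat) (D : rootDatum n).
Implicit Types (a b e : 'rV[int]_n) (x y : 'cV[int]_n) (M N : 'M[int]_n).
Implicit Types (i j : 'I_(ssrank D)).
Local Notation Phi := (Defs.roots D).
Local Notation s_ := (Defs.refl D).

Definition posb a : bool := `[< posroot D a >].

Lemma posbP a : reflect (posroot D a) (posb a).
Proof. exact: asboolP. Qed.

Lemma posroot_root a : posroot D a -> a \in Phi.
Proof. by case. Qed.

Lemma root_sign a : a \in Phi -> posroot D a \/ posroot D (- a).
Proof.
move=> aR; have [c [aE|aE]] := simple_sign aR; [left|right].
  by split=> //; exists c.
by split; [exact: root_opp | exists c; rewrite aE opprK].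
Qed.

Lemma posrootN a : posroot D a -> ~ posroot D (- a).
Proof.
move=> [aR [c cE]] [_ [e eE]]; have /eqP := root_neq0 aR; apply.
have z : \sum_i ((c i + e i)%N : int) *: simple D i = 0.
  rewrite -[RHS](subrr a) {1}cE eE -big_split /=; apply: eq_bigr => i _.
  by rewrite PoszD scalerDl -!scaler_nat !natz.
rewrite cE big1 // => i _; have := simple_free z i.
by move=> /eqP; rewrite eqz_nat addn_eq0 => /andP[/eqP->].
Qed.

Lemma posbN a : a \in Phi -> posb (- a) = ~~ posb a.
Proof.
move=> aR; have [ap|an] := root_sign aR.
  rewrite (introT (posbP _) ap) /=; apply/posbP; exact: posrootN.
rewrite (introT (posbP _) an); apply/esym/posbP => ap; exact: (posrootN ap).
Qed.

Lemma simple_pos i : posroot D (simple D i).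
Proof.
split; first exact: simple_root.
exists (fun j => (j == i) : nat); rewrite (bigD1 i) //= eqxx big1 ?addr0 //.
by move=> j /negPf->.
Qed.

(* A coefficient of a at another simple root is positive, and s_i does not
   change it. *)
Lemma refl_simple_pos a i :
  posroot D a -> a != simple D i -> posroot D (a *m s_ (simple D i)).
Proof.
move=> [aR [c cE]] ai; set s := simple D i.
have sR : s \in Phi by exact: simple_root.
have bR := root_mul_weyl (refl_weylmx sR) aR.
have [//|[_ [e eE]]] := root_sign bR; exfalso.
set k := pairZ a (coroot D s).
have z : \sum_j (((c j + e j)%N : int) - (j == i)%:R * k) *: simple D j = 0.
  transitivity (a + - (a *m s_ s) - k *: s).
    rewrite {1}cE eE -big_split /= -[k *: s]/(k *: simple D i).
    have -> : k *: simple D i = \sum_j ((j == i)%:R * k) *: simple D j.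
      rewrite (bigD1 i) //= eqxx mul1r big1 ?addr0 // => j /negPf->.
      by rewrite mul0r scale0r.
    rewrite -sumrB; apply: eq_bigr => j _.
    by rewrite PoszD scalerBl scalerDl -!scaler_nat !natz.
  by rewrite mulmx_refl opprB addrCA subrr addr0 subrr.
have cj j : j != i -> c j = 0%N.
  move=> ji; have := simple_free z j; rewrite (negPf ji) mul0r subr0.
  by move=> /eqP; rewrite eqz_nat addn_eq0 => /andP[/eqP->].
have aE : a = (c i : int) *: s.
  rewrite cE (bigD1 i) //= big1 => [|j /cj->] //.
  by rewrite addr0 -natz scaler_nat.
have [] : a = s \/ a = - s.
- by apply: (roots_reduced sR aR); exists 1, (c i); rewrite scale1r.
- by move/eqP: ai.
- move=> aN; case: (posrootN (simple_pos i)); rewrite -/s -aN; split=> //.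
  by exists c.
Qed.

Definition posroots : seq 'rV[int]_n := [seq a <- Phi | posb a].

Lemma mem_posroots a : (a \in posroots) = posb a.
Proof.
rewrite mem_filter; case: (posbP a) => //= - [aR _]; exact: aR.
Qed.

Lemma uniq_posroots : uniq posroots.
Proof. exact/filter_uniq/fset_uniq. Qed.

Definition absr a := if posb a then a else - a.

Lemma absr_pos a : a \in Phi -> posb (absr a).
Proof.
by move=> aR; rewrite /absr; case: ifP => // /negbT; rewrite posbN.
Qed.

Lemma absr_id a : posb a -> absr a = a.
Proof. by rewrite /absr => ->. Qed.

Lemma posb_root a : posb a -> a \in Phi.
Proof. by move=> /posbP[]. Qed.

Lemma posroots_weyl_perm M : weylmx D M ->
  perm_eq [seq absr (a *m M) | a <- posroots] posroots.
Proof.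
move=> wM; have [u wi] := weylmx_inv wM.
have aM a N : weylmx D N -> a \in posroots -> a *m N \in Phi.
  by rewrite mem_posroots => wN /posb_root; apply: root_mul_weyl.
apply: uniq_perm; [rewrite map_inj_in_uniq|exact: uniq_posroots|].
- exact: uniq_posroots.
- move=> a b; rewrite !mem_posroots => pa pb.
  have inj := weyl_mul_inj wM.
  have N : a = - b -> a = b.
    move=> abN; move: pa; rewrite abN posbN ?pb //; exact: posb_root.
  rewrite /absr; case: ifP; case: ifP => _ _.
  + by move/inj.
  + by rewrite -mulNmx => /inj.
  + by rewrite -mulNmx => /(@inj (- a) b) E; apply: N; rewrite -E opprK.
  + by move/oppr_inj/inj.
- move=> a; apply/mapP/idP => [[b bp ->]|ap].
    by rewrite mem_posroots absr_pos //; apply: aM.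
  have bR := aM _ _ wi ap.
  exists (absr (a *m invmx M)); first by rewrite mem_posroots absr_pos.
  rewrite {2}/absr; case: ifP => _; rewrite ?mulNmx mulmxKV //.
    by rewrite absr_id // -mem_posroots.
  rewrite mem_posroots in ap; have aR := posb_root ap.
  by rewrite /absr posbN // ap opprK.
Qed.

(** An even function of roots is a function of the pairs {a, -a}, which W permutes. This is the
    reindexing behind all length formulas below. *)
Lemma sum_posroots_weyl M (F : 'rV[int]_n -> nat) :
  weylmx D M -> (forall a, a \in Phi -> F (- a) = F a) ->
  (\sum_(a <- posroots) F (a *m M) = \sum_(a <- posroots) F a)%N.
Proof.
move=> wM FN; rewrite -[RHS](perm_big _ (posroots_weyl_perm wM)) /= big_map.
apply: eq_big_seq => a; rewrite mem_posroots => /posb_root aR.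
by rewrite /absr; case: ifP => // _; rewrite FN //; apply: root_mul_weyl.
Qed.

Lemma refl_simple_perm i (s := simple D i) :
  perm_eq [seq a *m s_ s | a <- rem s posroots] (rem s posroots).
Proof.
have sR : s \in Phi by exact: simple_root.
have U : uniq (rem s posroots) by rewrite rem_uniq // uniq_posroots.
have sub a : a \in rem s posroots -> a *m s_ s \in rem s posroots.
  rewrite !mem_rem_uniq ?uniq_posroots // !inE !mem_posroots.
  move=> /andP[as_ /posbP ap]; have bp := refl_simple_pos ap as_.
  rewrite (introT (posbP _) bp) andbT; apply: contraPneq as_ => E.
  have aE : a = - s.
    by rewrite -(mulmx1 a) -(refl_invol sR) mulmxA E mulmx_refl_id.
  by move: ap; rewrite aE => /(posrootN (simple_pos i)).
apply: uniq_perm => //; first by rewrite map_inj_uniq //; apply/weyl_mul_inj/refl_weylmx.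
move=> a; apply/mapP/idP => [[b br ->]|ar]; first exact: sub.
by exists (a *m s_ s); [exact: sub|rewrite -mulmxA refl_invol // mulmx1].
Qed.

(** Twice the half sum of the positive coroots: a height function on positive roots and, scaled
    down, an interior point of A_f. *)
Definition rho2 : 'cV[int]_n := \sum_(a <- posroots) coroot D a.

(** The reflection s_i permutes the positive coroots other than its own, which it negates; so it
    lowers [rho2] by twice that coroot. *)
Lemma simple_rho2 i : pairZ (simple D i) rho2 = 2.
Proof.
set s := simple D i; have sR : s \in Phi by exact: simple_root.
have sp : s \in posroots by rewrite mem_posroots; apply/posbP/simple_pos.
have P := refl_simple_perm i; rewrite -/s in P.
have E : s_ s *m rho2 = rho2 - 2 *: coroot D s.
  rewrite /rho2 (big_rem s) //= mulmxDr refl_mulmx pair_coroot // addrAC.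
  congr (_ + _ - _); rewrite mulmx_sumr -[RHS](perm_big _ P) big_map /=.
  apply: eq_big_seq => a; rewrite mem_rem_uniq ?uniq_posroots // inE mem_posroots.
  by move=> /andP[_ /posb_root aR]; rewrite coroot_refl.
have := congr1 (pairZ s) E; rewrite refl_mulmx !pairZBr !pairZZr pair_coroot //.
lia.
Qed.

Lemma posroot_rho2 a : posroot D a -> 0 < pairZ a rho2.
Proof.
move=> [aR [c cE]]; have /eqP a0 := root_neq0 aR.
have E : pairZ a rho2 = (\sum_i c i * 2)%N%:Z.
  rewrite cE pairZ_suml -natz raddf_sum /=; apply: eq_bigr => i _.
  by rewrite pairZMnl simple_rho2 natrM mulr_natl -mulrnA mulnC mulrnA.
rewrite E ltz_nat lt0n sum_nat_eq0; apply/negP => /forallP z; apply: a0.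
rewrite cE big1 // => i _; have := z i; rewrite muln_eq0 orbF /= => /eqP->.
by rewrite mulr0n.
Qed.

(* Some simple root has positive pairing with the coroot of a, so reflecting a
   in it lowers the height. *)
Lemma refl_simple_gen a : posroot D a ->
  exists s : seq 'I_(ssrank D), s_ a = \prod_(i <- s) s_ (simple D i).
Proof.
have [k] := ubnP `|pairZ a rho2|%N; elim: k a => // k IHk a ak ap.
have [[i ai]|ns] := pselect (exists i, a = simple D i).
  by exists [:: i]; rewrite big_seq1 ai.
have aR := posroot_root ap.
have [i ai] : exists i, 0 < pairZ a (coroot D (simple D i)).
  apply: contrapT => no; have := pair_coroot aR; have [_ [c cE]] := ap.
  rewrite {1}cE pairZ_suml => E; suff : (2 : int) <= 0 by [].
  rewrite -E; apply: sumr_le0 => i _; rewrite pairZMnl mulrn_wle0 //.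
  rewrite leNgt; apply/negP => si; apply: no; exists i.
  have iR := simple_root i.
  (* Both pairings between the two roots and coroots are positive multiples of one value of [rform],
     hence have the same sign. *)
  have f1 := rform_coroot (coroot D a) iR.
  have f2 := rform_coroot (coroot D (simple D i)) aR.
  have p1 := rform_coroot_gt0 iR; have p2 := rform_coroot_gt0 aR.
  rewrite rformC f2 in f1.
  by rewrite -(pmulr_lgt0 _ p2) f1 pmulr_lgt0.
set t := simple D i; have tR : t \in Phi by exact: simple_root.
have at_ : a != t by apply/eqP => E; apply: ns; exists i.
have bp := refl_simple_pos ap at_.
have [|s sE] := IHk _ _ bp.
  have := posroot_rho2 bp; have := posroot_rho2 ap; move: ak.
  by rewrite mulmx_refl pairZBl pairZZl simple_rho2 -/t in ai *; lia.
exists (i :: rcons s i).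
have E := refl_conj (refl_weylmx tR) aR.
rewrite big_cons -cats1 big_cat big_seq1 /= -sE -/t.
rewrite -!/(_ *m _) -[RHS]/(s_ t *m (_ *m s_ t)) mulmxA E -mulmxA refl_invol //.
by rewrite mulmx1.
Qed.

Lemma weyl_simple_gen M : weylmx D M ->
  exists s : seq 'I_(ssrank D), M = \prod_(i <- s) s_ (simple D i).
Proof.
move=> [r + ->]; elim: r => [|a r IHr] rR; first by exists [::]; rewrite !big_nil.
have [|s sE] := IHr; first by move=> b br; apply: rR; rewrite inE br orbT.
have aR : a \in Phi by apply: rR; rewrite mem_head.
have [t tE] : exists t : seq 'I_(ssrank D), s_ a = \prod_(i <- t) s_ (simple D i).
  have [/refl_simple_gen//|/refl_simple_gen] := root_sign aR.
  by rewrite reflN.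
by exists (t ++ s); rewrite big_cons big_cat tE sE.
Qed.

Lemma simple_weylmx (s : seq 'I_(ssrank D)) :
  weylmx D (\prod_(i <- s) s_ (simple D i)).
Proof.
exists [seq simple D i | i <- s]; last by rewrite big_map.
by move=> a /mapP[i _ ->]; apply: simple_root.
Qed.

(** Reading the word from the left, alpha_i turns negative at some letter j. Just before, it has
    become alpha_j, so moving s_i through the prefix turns it into s_j, which cancels that
    letter. *)
Lemma exchange i (s : seq 'I_(ssrank D)) :
  ~ posroot D (simple D i *m \prod_(j <- s) s_ (simple D j)) ->
  exists2 t : seq 'I_(ssrank D), size s = (size t).+1 &
    s_ (simple D i) *m \prod_(j <- s) s_ (simple D j) =
      \prod_(j <- t) s_ (simple D j).
Proof.
elim/last_ind: s => [|s j IHs]; first by rewrite big_nil mulmx1 => /(_ (simple_pos i)).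
set M := \prod_(j <- s) s_ (simple D j) in IHs *.
rewrite -cats1 big_cat big_seq1 -/M /= -[_ * _]/(_ *m _) mulmxA => np.
have [Mp|Mn] := pselect (posroot D (simple D i *m M)); last first.
  have [t st tE] := IHs Mn; exists (rcons t j); first by rewrite cats1 !size_rcons st.
  by rewrite mulmxA tE -cats1 big_cat big_seq1.
have E : simple D i *m M = simple D j.
  by apply/eqP; apply: contrapT => /negP ne; apply: np; apply: refl_simple_pos.
exists s; first by rewrite cats1 size_rcons.
have iR := simple_root i.
rewrite mulmxA -refl_conj //; last exact: simple_weylmx.
by rewrite E -mulmxA refl_invol ?mulmx1 //; apply: simple_root.
Qed.

(** If M = s_i N then alpha_i N is the opposite of the positive root alpha_i M, so [exchange]
    replaces the word by a shorter one. *)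
Lemma weyl_id M : weylmx D M ->
  (forall i, posroot D (simple D i *m M)) -> M = 1%:M.
Proof.
move=> /weyl_simple_gen[s]; have [k] := ubnP (size s).
elim: k s M => // k IHk [|i s] M sk ->; first by rewrite big_nil.
have iR := simple_root i.
rewrite big_cons -[_ * _]/(_ *m _) => Mp.
have [|t st tE] := @exchange i s.
  move: (Mp i); rewrite mulmxA mulmx_refl_id // mulNmx => p /posrootN; exact.
apply: (IHk t); rewrite ?tE //; first by move: sk; rewrite /= st; lia.
by move=> j; rewrite -tE.
Qed.

End Positive.

(** * Alcoves as floor functions *)

Section PairR.
Variables (R : realType) (n : nat).
Implicit Types (a b : 'rV[int]_n) (x y : 'cV[R]_n).

Lemma pairRDr a x y : pairR a (x + y) = pairR a x + pairR a y.
Proof. by rewrite /pairR mulmxDr mxE. Qed.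

Lemma pairRNr a x : pairR a (- x) = - pairR a x.
Proof. by rewrite /pairR mulmxN mxE. Qed.

Lemma pairRBr a x y : pairR a (x - y) = pairR a x - pairR a y.
Proof. by rewrite pairRDr pairRNr. Qed.

Lemma pairRZr k a x : pairR a (k *: x) = k * pairR a x.
Proof. by rewrite /pairR -scalemxAr mxE. Qed.

Lemma pairRDl a b x : pairR (a + b) x = pairR a x + pairR b x.
Proof. by rewrite /pairR map_mxD mulmxDl mxE. Qed.

Lemma pairRNl a x : pairR (- a) x = - pairR a x.
Proof. by rewrite /pairR map_mxN mulNmx mxE. Qed.

Lemma pairR0l x : pairR 0 x = 0.
Proof. by rewrite /pairR map_mx0 mul0mx mxE. Qed.

Lemma pairRZl k a x : pairR (k *: a) x = k%:~R * pairR a x.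
Proof. by rewrite /pairR map_mxZ -scalemxAl mxE. Qed.

Lemma pairR_suml (I : Type) (r : seq I) (P : pred I) F x :
  pairR (\sum_(i <- r | P i) F i) x = \sum_(i <- r | P i) pairR (F i) x.
Proof.
exact: (big_morph (fun a => pairR a x) (fun a b => pairRDl a b x) (pairR0l x)).
Qed.

Lemma pairRMnl a k x : pairR (a *+ k) x = pairR a x *+ k.
Proof. by elim: k => [|k IHk]; rewrite ?pairR0l // !mulrS pairRDl IHk. Qed.

Lemma pairR_map a (x : 'cV[int]_n) :
  pairR a (map_mx intr x : 'cV[R]_n) = (pairZ a x)%:~R.
Proof. by rewrite /pairR -map_mxM mxE. Qed.

Lemma pairR_inj a b : (forall x, pairR a x = pairR b x) -> a = b.
Proof.
move=> ab; apply: pairZ_inj => x; have := ab (map_mx intr x).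
by rewrite !pairR_map => /intr_inj.
Qed.

End PairR.

Section Action.
Variables (R : realType) (n : nat) (D : rootDatum n).
Local Notation V := 'cV[R]_n.
Implicit Types (a b : 'rV[int]_n) (x y : V) (v w : wext D).

Lemma pairR_act a v x :
  pairR a (act v x) = (pairZ a (val v).1)%:~R + pairR (a *m (val v).2) x.
Proof. by rewrite /act pairRDr pairR_map /pairR map_mxM mulmxA. Qed.

Lemma act1 x : act (1%g : wext D) x = x.
Proof. by rewrite /act /= map_mx0 add0r map_mx1 mul1mx. Qed.

Lemma actM v w x : act (v * w)%g x = act v (act w x).
Proof. by rewrite /act /= map_mxD !map_mxM mulmxDr mulmxA addrA. Qed.

Lemma actKV v : cancel (@act R n D v^-1%g) (act v).
Proof. by move=> x; rewrite -actM mulgV act1. Qed.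

Lemma act_imageM v w (A : set V) :
  act (v * w)%g @` A = act v @` (act w @` A).
Proof. by rewrite image_comp; apply: eq_imagel => x _; rewrite actM. Qed.

End Action.

Section Floors.
Variables (n : nat) (D : rootDatum n).
Implicit Types (a b : 'rV[int]_n) (v w : wext D).
Local Notation Phi := (Defs.roots D).

(* The integer k with k < a < k + 1 on the interior of the alcove v . A_f. *)
Definition vfloor v a : int :=
  pairZ a (val v).1 - (~~ posb D (a *m (val v).2) : nat)%:Z.

Lemma wext_root v a : a \in Phi -> a *m (val v).2 \in Phi.
Proof. exact/root_mul_weyl/wextP. Qed.

Lemma vfloor_opp v a : a \in Phi -> vfloor v (- a) = - vfloor v a - 1.
Proof.
move=> aR; rewrite /vfloor mulNmx posbN ?wext_root // pairZNl.
by case: posb => /=; lia.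
Qed.

Lemma vfloor1 a : vfloor 1%g a = - (~~ posb D a : nat)%:Z.
Proof. by rewrite /vfloor /= pairZ0r mulmx1 sub0r. Qed.

End Floors.

Section Alcove.
Variables (R : realType) (n : nat) (D : rootDatum n).
Local Notation V := 'cV[R]_n.
Implicit Types (a b : 'rV[int]_n) (x y : V) (v w : wext D).
Local Notation Phi := (Defs.roots D).
Local Notation Af := (@fund_alcove R n D).

(** The pairings of [rho2] with positive roots are positive, so one more than their sum exceeds each
    of them, and dividing by it brings all values strictly between 0 and 1. *)
Definition base_point : V :=
  ((\sum_(a <- posroots D) pairZ a (rho2 D) + 1)%:~R)^-1 *: map_mx intr (rho2 D).

Lemma base_point_pos a : posroot D a -> 0 < pairR a base_point < 1.
Proof.
move=> ap; rewrite /base_point; set N := \sum_(b <- _) _.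
have ain : a \in posroots D by rewrite mem_posroots; apply/posbP.
have h := posroot_rho2 ap.
have hN : pairZ a (rho2 D) <= N.
  rewrite /N (big_rem a) //= lerDl big_seq; apply: sumr_ge0 => b.
  by move=> /mem_rem; rewrite mem_posroots => /posbP/posroot_rho2/ltW.
rewrite pairRZr pairR_map mulrC.
have N0 : 0 < (N + 1)%:~R :> R by rewrite ltr0z; lia.
apply/andP; split; first by rewrite divr_gt0 // ltr0z.
by rewrite ltr_pdivrMr // mul1r ltr_int; lia.
Qed.

Definition alc_point v : V := act v base_point.

Lemma base_point_root b : b \in Phi ->
  - (~~ posb D b : nat)%:~R < pairR b base_point < 1 - (~~ posb D b : nat)%:~R.
Proof.
move=> bR; case: (posbP D b) => [bp|bn] /=.
  by have /andP[h1 h2] := base_point_pos bp; apply/andP; split; lra.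
have [//|/base_point_pos] := root_sign bR.
by rewrite pairRNl => /andP[h1 h2]; apply/andP; split; lra.
Qed.

Lemma alc_point_bounds v a : a \in Phi ->
  (vfloor v a)%:~R < pairR a (alc_point v) < (vfloor v a + 1)%:~R.
Proof.
move=> aR; have := base_point_root (wext_root v aR).
rewrite /alc_point pairR_act /vfloor !intrD intrN => /andP[h1 h2].
by apply/andP; split; lra.
Qed.

Definition alc v : set V := act v @` Af.

Lemma alcP v x : alc v x <->
  forall a, a \in Phi -> (vfloor v a)%:~R <= pairR a x <= (vfloor v a + 1)%:~R.
Proof.
split=> [[y yA <-] a aR|h].
  rewrite pairR_act /vfloor !intrD intrN; set b := a *m _.
  have bR : b \in Phi by exact: wext_root.
  case: (posbP D b) => [/yA/andP[h1 h2]|bn] /=; first by apply/andP; split; lra.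
  have [//|/yA] := root_sign bR.
  by rewrite pairRNl => /andP[h1 h2]; apply/andP; split; lra.
set y := act v^-1%g x; have xE : x = act v y by rewrite actKV.
exists y => //; rewrite xE in h.
move=> b bp; have bR := posroot_root bp.
have [u wi] := weylmx_inv (wextP v).
have := h (b *m invmx (val v).2) (root_mul_weyl wi bR).
rewrite pairR_act /vfloor mulmxKV //.
rewrite (introT (posbP _ _) bp) /= !intrD intrN => /andP[h1 h2].
by apply/andP; split; lra.
Qed.

Lemma alc_posP v x : alc v x <->
  forall a, posroot D a -> (vfloor v a)%:~R <= pairR a x <= (vfloor v a + 1)%:~R.
Proof.
split=> [/alcP h a /posroot_root/h //|h]; apply/alcP => a aR.
have [/h//|ap] := root_sign aR; have := h _ ap.
rewrite vfloor_opp // pairRNl; move: (vfloor v a) => k; rewrite !intrD !intrN => /andP[h1 h2].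
by apply/andP; split; lra.
Qed.

Lemma alc_point_alc v : alc v (alc_point v).
Proof. by apply/alcP => a aR; have /andP[h1 h2] := alc_point_bounds v aR; rewrite !ltW. Qed.

Lemma alc1 : alc 1%g = Af.
Proof.
by apply/seteqP; split=> [x [y yA <-]|x xA]; [rewrite act1|exists x; rewrite ?act1].
Qed.

Lemma alcM v w : alc (v * w)%g = act v @` alc w.
Proof. by rewrite /alc act_imageM. Qed.

Lemma alc_vfloor v w : alc v = alc w -> forall a, a \in Phi -> vfloor v a = vfloor w a.
Proof.
move=> vw a aR.
have : alc v (alc_point w) by rewrite vw; exact: alc_point_alc.
move=> /alcP/(_ a aR)/andP[h1 h2]; have /andP[h3 h4] := alc_point_bounds w aR.
have := le_lt_trans h1 h4; have := lt_le_trans h3 h2; rewrite !ltr_int; lia.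
Qed.

Lemma vfloor_alc v w : (forall a, posroot D a -> vfloor v a = vfloor w a) -> alc v = alc w.
Proof.
move=> vw; apply/seteqP; split=> x /alc_posP h; apply/alc_posP => a ap.
  by rewrite -vw // h.
by rewrite vw // h.
Qed.

Lemma omega_alc g : Omega R g <-> alc g = alc 1%g.
Proof. by rewrite alc1. Qed.

Lemma vfloor_omega v g a : Omega R g -> a \in Phi -> vfloor (v * g)%g a = vfloor v a.
Proof.
by move=> /omega_alc og aR; apply: alc_vfloor => //; rewrite alcM og -alcM mulg1.
Qed.

Lemma alc_halfspace_le v a m : a \in Phi ->
  alc v `<=` halfspace_le a m <-> vfloor v a < m.
Proof.
move=> aR; split=> [h|vm x /alcP/(_ a aR)/andP[_ h]].
  have := h _ (alc_point_alc v); rewrite /halfspace_le /=.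
  by have /andP[h1 h2] := alc_point_bounds v aR => /(lt_le_trans h1); rewrite ltr_int.
by apply: le_trans h _; rewrite ler_int; lia.
Qed.

Lemma alc_halfspace_ge v a m : a \in Phi ->
  alc v `<=` halfspace_ge a m <-> m <= vfloor v a.
Proof.
move=> aR; split=> [h|vm x /alcP/(_ a aR)/andP[h _]].
  have := h _ (alc_point_alc v); rewrite /halfspace_ge /=.
  have /andP[h1 h2] := alc_point_bounds v aR => /le_lt_trans/(_ h2).
  by rewrite ltr_int; lia.
by apply: le_trans h; rewrite ler_int.
Qed.

(** Translating inside H_{a,m} shows that b vanishes on the kernel of a; hence b is proportional to
    a, and reducedness leaves only the two signs. *)
Lemma hyp_eq a b m j : a \in Phi -> b \in Phi ->
  @hyp R n a m = hyp b j -> a = b /\ m = j \/ a = - b /\ m = - j.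
Proof.
move=> aR bR E.
pose c : V := map_mx intr (coroot D a).
have ac : pairR a c = 2 by rewrite pairR_map pair_coroot.
have h0 : hyp b j ((m%:~R / 2) *: c).
  by rewrite -E /hyp /= pairRZr ac divfK // pnatr_eq0.
have hz (z : V) : pairR b z = pairR a z / 2 * pairR b c.
  have : hyp b j ((m%:~R / 2) *: c + (z - (pairR a z / 2) *: c)).
    rewrite -E /hyp /= pairRDr pairRBr !pairRZr ac; lra.
  move: h0; rewrite /hyp /= pairRDr pairRBr !pairRZr => -> ; lra.
have prop : 2 *: b = pairZ b (coroot D a) *: a.
  apply: (@pairR_inj R) => z; rewrite !pairRZl hz pairR_map; lra.
have [] : b = a \/ b = - a.
- by apply: (roots_reduced aR bR); exists 2, (pairZ b (coroot D a)).
- move=> ba; left; split=> //; move: h0; rewrite ba /hyp /= pairRZr ac divfK ?pnatr_eq0 //.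
  by move/intr_inj.
- move=> ba; right; rewrite ba opprK; split=> //; move: h0.
  rewrite ba /hyp /= pairRNl pairRZr ac divfK ?pnatr_eq0 // -intrN => /intr_inj; lia.
Qed.

End Alcove.

(** * Walls of the fundamental alcove *)

Lemma minimal_subseq (T : eqType) (P : seq T -> Prop) (s : seq T) : P s ->
  exists t, [/\ {subset t <= s}, P t & forall c, c \in t -> ~ P (rem c t)].
Proof.
have [k] := ubnP (size s); elim: k s => // k IHk s sk Ps.
have [min|/existsNP[c /not_implyP[cs /contrapT Prem]]] :=
  pselect (forall c, c \in s -> ~ P (rem c s)); first by exists s; split.
have [|t [ts Pt tmin]] := IHk _ _ Prem.
  move: sk; rewrite size_rem //; have : (0 < size s)%N by case: (s) cs.
  lia.
by exists t; split=> // e /ts/mem_rem.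
Qed.

Section Walls.
Variables (R : realType) (n : nat) (D : rootDatum n).
Local Notation V := 'cV[R]_n.
Implicit Types (a b : 'rV[int]_n) (x y : V) (v w s : wext D).
Local Notation Phi := (Defs.roots D).
Local Notation Af := (@fund_alcove R n D).
Local Notation k0 := (@vfloor n D 1%g).

Lemma fund_alcoveP x :
  Af x <-> forall a, a \in Phi -> (k0 a)%:~R <= pairR a x.
Proof.
rewrite -alc1; split=> [/alcP h a /h/andP[]//|h]; apply/alcP => a aR.
rewrite h //=; have := h _ (root_opp aR).
rewrite vfloor_opp // pairRNl; move: (vfloor _ _) => k; rewrite !intrD !intrN; lra.
Qed.

(** Moving p by e along z, in either direction, preserves finitely many inequalities that are strict
    at p. *)
Lemma small_shift (p z : V) (r : seq 'rV[int]_n) :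
  (forall c, c \in r -> (k0 c)%:~R < pairR c p) ->
  exists2 e : R, 0 < e & forall c, c \in r ->
    e * `|pairR c z| <= pairR c p - (k0 c)%:~R.
Proof.
elim: r => [|c r IHr] h; first by exists 1.
have [|e e0 he] := IHr; first by move=> b br; apply: h; rewrite inE br orbT.
have hc := h c (mem_head _ _).
(* The 1 in the denominator covers the case where c vanishes on z. *)
set f := (pairR c p - (k0 c)%:~R) / (`|pairR c z| + 1).
have d0 : 0 < `|pairR c z| + 1 by have := normr_ge0 (pairR c z); lra.
have f0 : 0 < f by rewrite divr_gt0 // subr_gt0.
exists (Num.min e f); first by rewrite lt_min e0.
move=> b; rewrite inE => /predU1P[->|br].
  apply: le_trans (_ : f * `|pairR c z| <= _).
    by rewrite ler_wpM2r // ge_min lexx orbT.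
  rewrite /f mulrAC ler_pdivrMr // ler_wpM2l ?subr_ge0 ?ltW //; lra.
by apply: le_trans (he _ br); rewrite ler_wpM2r // ge_min lexx.
Qed.

(* A violated inequality of an irredundant subsystem defining A_f comes from a
   wall: near the point p only this inequality is tight. *)
Lemma separating_wall x : ~ Af x ->
  exists b, [/\ b \in Phi, wall D Af (hyp b (k0 b)) & pairR b x < (k0 b)%:~R].
Proof.
move=> xA.
pose P (J : seq 'rV[int]_n) :=
  forall y, (forall c, c \in J -> (k0 c)%:~R <= pairR c y) -> Af y.
have [|J [JPhi PJ Jmin]] := @minimal_subseq _ P (enum_fset Phi).
  by move=> y h; apply/fund_alcoveP.
have [j jJ jx] : exists2 j, j \in J & pairR j x < (k0 j)%:~R.
  apply: contrapT => no; apply/xA/PJ => c cJ; rewrite leNgt; apply/negP => cx.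
  by apply: no; exists c.
have jR : j \in Phi by exact: JPhi.
exists j; split=> //; split; first by exists j, (k0 j).
(* Dropping j from the irredundant system admits a point y outside A_f, which violates j alone among
   the members of J. *)
have /existsNP[y /not_implyP[hy yA]] := Jmin j jJ.
have jy : pairR j y < (k0 j)%:~R.
  rewrite ltNge; apply/negP => jy; apply/yA/PJ => c cJ.
  have [->//|cj] := eqVneq c j.
  by apply: hy; rewrite rem_mem.
have x0k c : c \in Phi -> (k0 c)%:~R < pairR c (base_point R D).
  by move=> cR; have /andP[] := alc_point_bounds R 1%g cR; rewrite /alc_point act1.
set x0 := base_point R D in x0k.
have jx0 := x0k j jR.
(* The segment from the interior point [x0] to y meets the hyperplane of j at p. The other members
   of J are strict at [x0], hold at y, and t < 1, so they are strict at p. *)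
pose t : R := (pairR j x0 - (k0 j)%:~R) / (pairR j x0 - pairR j y).
have d0 : 0 < pairR j x0 - pairR j y by lra.
have t0 : 0 < t by rewrite divr_gt0 //; lra.
have t1 : t < 1 by rewrite ltr_pdivrMr //; lra.
pose p : V := x0 + t *: (y - x0).
have pE c : pairR c p = (1 - t) * pairR c x0 + t * pairR c y.
  rewrite /p pairRDr pairRZr pairRBr; ring.
have jp : pairR j p = (k0 j)%:~R.
  have : t * (pairR j x0 - pairR j y) = pairR j x0 - (k0 j)%:~R.
    by rewrite divfK // gt_eqF.
  rewrite pE => h; rewrite -[RHS](subKr (pairR j x0)) -h; ring.
have cp c : c \in rem j J -> (k0 c)%:~R < pairR c p.
  move=> cr; have cR : c \in Phi by apply/JPhi/(mem_rem cr).
  rewrite pE; have := hy c cr; have := x0k c cR; nra.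
have Ap : Af p.
  apply: PJ => c cJ; have [->|cj] := eqVneq c j; first by rewrite jp.
  by apply/ltW/cp; rewrite rem_mem.
(* A root c whose lower bound is attained at p vanishes on the kernel of j, because p can be moved
   both ways along this kernel inside A_f; so c is proportional to j. *)
have main c : c \in Phi -> pairR c p = (k0 c)%:~R -> c = j.
  move=> cR cpE.
  have z0 (z : V) : pairR j z = 0 -> pairR c z = 0.
    move=> jz; have [e e0 he] := small_shift z cp.
    have sh (s : R) : `|s| = e -> 0 <= s * pairR c z.
      move=> se; have : Af (p + s *: z).
        apply: PJ => b bJ; rewrite pairRDr pairRZr.
        have [->|bj] := eqVneq b j; first by rewrite jp jz mulr0 addr0.
        have := he b; rewrite rem_mem // => /(_ isT); rewrite -se -normrM.
        have := ler_norm (- (s * pairR b z)); rewrite normrN; lra.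
      move=> /fund_alcoveP/(_ _ cR); rewrite pairRDr pairRZr cpE; lra.
    have := sh e (gtr0_norm e0); have := sh (- e); rewrite normrN gtr0_norm //.
    move=> /(_ erefl); nra.
  pose jc : V := map_mx intr (coroot D j).
  have jj : pairR j jc = 2 by rewrite pairR_map pair_coroot.
  have prop : 2 *: c = pairZ c (coroot D j) *: j.
    apply: (@pairR_inj R) => z; rewrite !pairRZl.
    have := z0 (z - (pairR j z / 2) *: jc); rewrite !pairRBr !pairRZr jj.
    rewrite -[(pairZ _ _)%:~R]pairR_map -/jc => h.
    have {}h := h _; have : pairR c z - pairR j z / 2 * pairR c jc = 0 by apply: h; lra.
    lra.
  have [//|cN] : c = j \/ c = - j.
    by apply: (roots_reduced jR cR); exists 2, (pairZ c (coroot D j)).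
  by move: cpE; rewrite cN pairRNl jp vfloor_opp // -intrN => /intr_inj; clear; lia.
exists p => // h' [c [m [cR ->]]]; rewrite /hyp /= => cpm.
have /alcP/(_ c cR) : alc (1%g : wext D) p by rewrite alc1.
rewrite cpm !ler_int => /andP[m1 m2].
(* An integral value of c on A_f is an end of its interval, and the upper end for c is the lower end
   for -c. *)
have [mE|mE] : m = k0 c \/ m = k0 c + 1 by move: m1 m2; clear; lia.
  by rewrite mE -(main c) // cpm mE.
have E : - c = j.
  by apply: main; rewrite ?root_opp // pairRNl cpm vfloor_opp // mE -intrN;
     congr (_%:~R); clear; lia.
have -> : k0 j = - m by rewrite -E vfloor_opp // mE; clear; lia.
rewrite -E; apply/seteqP; split=> z /=; rewrite pairRNl intrN; lra.
Qed.

Definition aref a (aR : a \in Phi) (m : int) : wext D :=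
  mkwext (m *: coroot D a) (refl_weylmx aR).

Lemma Sa_aref a (aR : a \in Phi) m : wall D Af (hyp a m) -> Sa R (aref aR m).
Proof. by exists a, m. Qed.

Lemma act_aref a (aR : a \in Phi) m x :
  pairR a x = m%:~R -> act (aref aR m) x = x.
Proof.
move=> ax; rewrite /act /= /Defs.refl map_mxB map_mxM map_mx1 map_mxZ mulmxBl mul1mx.
rewrite -mulmxA (mx11_scalar (map_mx _ a *m x)) -/(pairR a x) ax mul_mx_scalar.
by rewrite addrC subrK.
Qed.

Lemma hyp_opp a m : @hyp R n (- a) (- m) = hyp a m.
Proof. by apply/seteqP; split=> z; rewrite /hyp /= pairRNl intrN; lra. Qed.

Lemma aref_conj v a b m (aR : a \in Phi) (bR : b \in Phi) :
  a *m (val v).2 = b ->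
  (v * aref bR m)%g = (aref aR (m + pairZ a (val v).1) * v)%g.
Proof.
move=> bE; apply/val_inj/pair_equal_spec; rewrite /= -bE.
split; last by apply/refl_conj/aR/wextP.
rewrite -scalemxAr coroot_weyl ?refl_mulmx //; last exact: wextP.
by rewrite scalerDl addrACA subrr addr0 addrC.
Qed.

Lemma vfloor_aref v a m (aR : a \in Phi) :
  vfloor (aref aR m * v)%g a = 2 * m - 1 - vfloor v a.
Proof.
rewrite /vfloor /= pairZDr pairZZr pair_coroot // -pairZ_mulmx !mulmxA.
rewrite mulmx_refl_id // !mulNmx pairZNl posbN ?wext_root //.
by case: posb => /=; lia.
Qed.

Lemma hyp_act_uniq v x a b m : b \in Phi -> a *m (val v).2 = b ->
  (forall h, hyperplane D h -> h x -> h = hyp b m) ->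
  forall c j, c \in Phi -> hyp c j (act v x) ->
    @hyp R n c j = hyp a (m + pairZ a (val v).1).
Proof.
move=> bR aE xu c j cR cj; have cMR := wext_root v cR.
have : @hyp R n (c *m (val v).2) (j - pairZ c (val v).1) = hyp b m.
  apply: xu; first by exists (c *m (val v).2), (j - pairZ c (val v).1).
  by move: cj; rewrite /hyp /= pairR_act intrD intrN; lra.
have inj := weyl_mul_inj (wextP v).
case/(hyp_eq cMR bR); rewrite -aE => -[].
  by move/inj => -> jE; congr hyp; lia.
rewrite -mulNmx => /inj ->; rewrite pairZNl => jE.
have -> : j = - (m + pairZ a (val v).1) by move: jE; clear; lia.
exact: hyp_opp.
Qed.

(** The point of the wall, moved by v, lies in both A_v and A_{vs} and on H_{a,m} only. Other roots
    are not integral there, so their floors agree; the reflection exchanges the floors k and 2m - 1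
    - k of a, and the value m at this point leaves only m - 1 and m. *)
Lemma Sa_step v s : Sa R s -> exists a m,
  [/\ posroot D a, val (v * s * v^-1)%g = (m *: coroot D a, Defs.refl D a),
      vfloor v a = m - 1 /\ vfloor (v * s)%g a = m \/
      vfloor v a = m /\ vfloor (v * s)%g a = m - 1 &
      forall b, posroot D b -> b != a -> vfloor (v * s)%g b = vfloor v b].
Proof.
move=> [b [m0 [bR [_ [x [xA xh] xu]] sE]]].
have {sE}sE : s = aref bR m0 by apply/val_inj.
have [u wi] := weylmx_inv (wextP v).
(* Stated for a positive root, so as to apply to b v^-1 or to its opposite, whichever is
   positive. *)
have main a m (ap : posroot D a) : (v * s = aref (posroot_root ap) m * v)%g ->
    (forall c j, c \in Phi -> hyp c j (act v x) -> @hyp R n c j = hyp a m) ->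
    hyp a m (act v x) ->
    [/\ val (v * s * v^-1)%g = (m *: coroot D a, Defs.refl D a),
      vfloor v a = m - 1 /\ vfloor (v * s)%g a = m \/
      vfloor v a = m /\ vfloor (v * s)%g a = m - 1 &
      forall c, posroot D c -> c != a -> vfloor (v * s)%g c = vfloor v c].
  have aR := posroot_root ap; move=> vs uq am.
  have {}am : pairR a (act v x) = m%:~R := am.
  have pv : alc v (act v x) by exists x.
  have pvs : alc (v * s)%g (act v x).
    by exists x => //; rewrite actM sE act_aref.
  split; first by rewrite vs mulgK.
    have /alcP/(_ a aR) := pv; rewrite am !ler_int vs vfloor_aref.
    by move: (vfloor v a) => k /andP[h1 h2]; lia.
  move=> c cp ca; have cR := posroot_root cp.
  have ni j : pairR c (act v x) != j%:~R.
    apply/eqP => cj; have := uq c j cR cj.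
    case/(hyp_eq cR aR) => -[cE _]; first by rewrite cE eqxx in ca.
    by apply: (posrootN ap); rewrite -cE.
  have str w : alc w (act v x) ->
      (vfloor w c)%:~R < pairR c (act v x) < (vfloor w c + 1)%:~R.
    by move=> /alcP/(_ c cR); rewrite !lt_neqAle ni eq_sym ni.
  have /andP[h1 h2] := str _ pv; have /andP[h3 h4] := str _ pvs.
  have := lt_trans h1 h4; have := lt_trans h3 h2; rewrite !ltr_int.
  by move: (vfloor _ _) (vfloor _ _) => k l; clear; lia.
pose a := b *m invmx (val v).2.
have aR : a \in Phi by exact: root_mul_weyl.
have aE : a *m (val v).2 = b by rewrite mulmxKV.
pose m := m0 + pairZ a (val v).1.
have vs : (v * s = aref aR m * v)%g.
  by rewrite sE; apply: aref_conj.
have am : hyp a m (act v x).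
  by rewrite /hyp /= pairR_act aE xh intrD addrC.
have uq c j : c \in Phi -> hyp c j (act v x) -> @hyp R n c j = hyp a m.
  by apply: (hyp_act_uniq bR aE).
have [ap|an] := root_sign aR.
  by exists a, m; have [|//|//|h1 h2 h3] := main a m ap;
    [rewrite vs; congr (_ * _)%g; apply/val_inj|split].
exists (- a), (- m); have [||//|h1 h2 h3] := main (- a) (- m) an; last by split.
- by rewrite vs; congr (_ * _)%g; apply/val_inj;
  rewrite /= corootN // reflN // scaleNr scalerN opprK.
- by move=> c j cR cj; rewrite hyp_opp; apply: uq.
- by rewrite hyp_opp.
Qed.

Lemma Sa_omega g s : Omega R g -> Sa R s -> Sa R (g * s * g^-1)%g.
Proof.
move=> og [b [m [bR [_ [x [xA xh] xu]] sE]]].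
have {sE}-> : s = aref bR m by apply/val_inj.
have [u wi] := weylmx_inv (wextP g).
pose a := b *m invmx (val g).2.
have aR : a \in Phi by exact: root_mul_weyl.
have aE : a *m (val g).2 = b by rewrite mulmxKV.
rewrite (aref_conj _ aR bR aE) mulgK; apply: Sa_aref; split.
  by exists a, (m + pairZ a (val g).1).
exists (act g x).
  split; first by rewrite -[X in X _]og; exists x.
  have {}xh : pairR b x = m%:~R := xh.
  by rewrite /hyp /= pairR_act aE xh intrD addrC.
by move=> h [c [j [cR ->]]]; apply: (hyp_act_uniq bR aE xu).
Qed.

Lemma aref_invol a (aR : a \in Phi) m : (aref aR m * aref aR m = 1)%g.
Proof.
apply/val_inj/pair_equal_spec; split=> /=; last exact: refl_invol.
by rewrite refl_mulmx pairZZr pair_coroot //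
  (_ : m * 2 = m + m) ?scalerDl ?addrA ?subrr //; clear; lia.
Qed.

Lemma Sa_invol s : Sa R s -> (s * s = 1)%g.
Proof.
move=> [b [m [bR _ sE]]]; have -> : s = aref bR m by apply/val_inj.
exact: aref_invol.
Qed.

Lemma Sa_inv s : Sa R s -> (s^-1 = s)%g.
Proof. by move=> /Sa_invol ss; rewrite -[LHS]mulg1 -ss mulKg. Qed.

(* The midpoint of the base point and its mirror image lies on no other
   hyperplane. *)
Lemma simple_wall i : wall D Af (hyp (simple D i) 0).
Proof.
set a := simple D i; have aR : a \in Phi by exact: simple_root.
split; first by exists a, 0.
pose x0 := base_point R D; pose ac : V := map_mx intr (coroot D a).
pose x : V := x0 - (pairR a x0 / 2) *: ac.
have xE b : pairR b x = (pairR b x0 + pairR (b *m Defs.refl D a) x0) / 2.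
  rewrite mulmx_refl pairRDl pairRNl pairRZl /x pairRBr pairRZr pairR_map; lra.
have ax : pairR a x = 0 by rewrite xE mulmx_refl_id // pairRNl; lra.
have bx b : posroot D b -> b != a -> 0 < pairR b x < 1.
  move=> bp ba; have /andP[h1 h2] := base_point_pos R bp.
  have /andP[h3 h4] := base_point_pos R (refl_simple_pos bp ba).
  by rewrite xE; apply/andP; split; lra.
exists x.
  split; last by rewrite /hyp /= ax.
  move=> b bp; have [->|ba] := eqVneq b a; first by rewrite ax lexx ler01.
  by have /andP[h1 h2] := bx b bp ba; rewrite !ltW.
have main b m : posroot D b -> hyp b m x -> @hyp R n b m = hyp a 0.
  move=> bp bm; have {}bm : pairR b x = m%:~R := bm.
  have [ba|ba] := eqVneq b a.
    have : (m%:~R : R) = 0%:~R by rewrite -bm ba ax.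
    by move=> /intr_inj ->; rewrite ba.
  have := bx b bp ba; rewrite bm ltr0z ltrz1; clear; lia.
move=> h [b [m [bR ->]]] bm; have [bp|bn] := root_sign bR; first exact: main.
by rewrite -hyp_opp; apply: main => //; rewrite hyp_opp.
Qed.

End Walls.

(** * Length and weighted length *)

(* From 0 < a < 1 to k < a < k + 1 one crosses H_{a,1}, ..., H_{a,k} if k >= 0,
   and H_{a,0}, ..., H_{a,k+1} if k < 0. *)
Definition wsum (f : int -> nat) (k : int) : nat :=
  match k with
  | Posz p => \sum_(i < p) f i.+1
  | Negz p => \sum_(i < p.+1) f (- (i : nat)%:Z)
  end.

Lemma wsum_up f (k : int) : 0 <= k -> wsum f (k + 1) = (wsum f k + f (k + 1)%R)%N.
Proof.
by case: k => // p _; rewrite -PoszD addn1 /= big_ord_recr.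
Qed.

Lemma wsum_down f (k : int) : k <= 0 -> wsum f (k - 1) = (wsum f k + f k)%N.
Proof.
move=> k0; have {k0} : exists p : nat, k = - p%:Z.
  by exists `|k|%N; move: k0; clear; lia.
case=> p ->; have -> : - p%:Z - 1 = Negz p by rewrite NegzE; clear; lia.
rewrite /wsum big_ord_recr /=; case: p => [|p].
  have -> : - (0 : nat)%:Z = Posz 0 by [].
  by rewrite !big_ord0.
by have -> : - p.+1%:Z = Negz p by rewrite NegzE.
Qed.

Section Length.
Variables (R : realType) (n : nat) (D : rootDatum n).
Implicit Types (a b : 'rV[int]_n) (v w s g : wext D) (f : 'rV[int]_n -> int -> nat).
Local Notation Phi := (Defs.roots D).

(* The number of hyperplanes H_{a,m} separating A_f and v . A_f, each counted
   with weight f a m. *)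
Definition sepw f v : nat := \sum_(a <- posroots D) wsum (f a) (vfloor v a).

Definition ell v : nat := sepw (fun _ _ => 1%N) v.

Lemma sepw_eq f v w : (forall a, posroot D a -> vfloor v a = vfloor w a) -> sepw f v = sepw f w.
Proof.
move=> vw; apply: eq_big_seq => a; rewrite mem_posroots => /posbP ap.
by rewrite vw.
Qed.

Lemma sepw_omega f v g : Omega R g -> sepw f (v * g)%g = sepw f v.
Proof.
by move=> og; apply: sepw_eq => a /posroot_root aR; apply: vfloor_omega og aR.
Qed.

Lemma sepw1 f : sepw f 1%g = 0%N.
Proof.
rewrite /sepw big1_seq // => a /andP[_]; rewrite mem_posroots => ap.
by rewrite vfloor1 ap oppr0 /= big_ord0.
Qed.

(** Quantified over all weights f, to serve the length and the weighted length at once; the absolute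
    values of the floors tell which of the two alcoves lies beyond H_{a,m} as seen from A_f. *)
Lemma Sa_cross v s : Sa R s -> exists a m,
  [/\ posroot D a, val (v * s * v^-1)%g = (m *: coroot D a, Defs.refl D a),
      forall b, posroot D b -> b != a -> vfloor (v * s)%g b = vfloor v b &
      (`|vfloor v a| < `|vfloor (v * s)%g a|)%N /\
        (forall f, sepw f (v * s)%g = sepw f v + f a m)%N \/
      (`|vfloor (v * s)%g a| < `|vfloor v a|)%N /\
        (forall f, sepw f v = sepw f (v * s)%g + f a m)%N].
Proof.
move=> /(Sa_step v)[a [m [ap vs vsa vsb]]]; exists a, m; split=> //.
have ain : a \in posroots D by rewrite mem_posroots; apply/posbP.
have aux f c : (wsum (f a) (vfloor (v * s)%g a) = wsum (f a) (vfloor v a) + c)%N ->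
    (sepw f (v * s)%g = sepw f v + c)%N.
  move=> E; rewrite /sepw !(big_rem a ain) /= E addnAC; congr (_ + _ + _)%N.
  apply: eq_big_seq => b; rewrite mem_rem_uniq ?uniq_posroots // inE mem_posroots.
  by case/andP=> ba /posbP bp; rewrite vsb.
have aux' f c : (wsum (f a) (vfloor v a) = wsum (f a) (vfloor (v * s)%g a) + c)%N ->
    (sepw f v = sepw f (v * s)%g + c)%N.
  move=> E; rewrite /sepw !(big_rem a ain) /= E addnAC; congr (_ + _ + _)%N.
  apply: eq_big_seq => b; rewrite mem_rem_uniq ?uniq_posroots // inE mem_posroots.
  by case/andP=> ba /posbP bp; rewrite vsb.
have mE : m = m - 1 + 1 by rewrite subrK.
(* As 0 < a < 1 inside A_f, A_f lies below H_{a,m} exactly when m is positive. *)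
have [m0|m0] := ltP 0 m.
  have up f : (wsum (f a) m = wsum (f a) (m - 1) + f a m)%N.
    by rewrite {1 3}mE; apply: wsum_up; move: m0; clear; lia.
  case: vsa => -[kv kvs]; rewrite kv kvs; [left|right]; split=> [|f]; try by move: m0; clear; lia.
    by apply: aux; rewrite kv kvs -up.
  by apply: aux'; rewrite kv kvs -up.
have down f : (wsum (f a) (m - 1) = wsum (f a) m + f a m)%N by exact: wsum_down.
case: vsa => -[kv kvs]; rewrite kv kvs; [right|left]; split=> [|f]; try by move: m0; clear; lia.
  by apply: aux'; rewrite kv kvs -down.
by apply: aux; rewrite kv kvs -down.
Qed.

End Length.

Section LengthFunction.
Variables (R : realType) (n : nat) (D : rootDatum n).
Implicit Types (a b : 'rV[int]_n) (v w s g : wext D) (f : 'rV[int]_n -> int -> nat).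
Implicit Types (ts us : seq (wext D)).
Local Notation Phi := (Defs.roots D).
Local Notation Af := (@fund_alcove R n D).
Local Notation Sa := (Sa R).
Local Notation Omega := (Omega R).

Lemma ell_Sa v s : Sa s ->
  ell (v * s)%g = (ell v).+1 \/ ell v = (ell (v * s)%g).+1.
Proof.
by move=> /(Sa_cross v)[a [m [_ _ _ [[_ E]|[_ E]]]]]; [left|right];
  rewrite -addn1; exact: E.
Qed.

Lemma ell_up v s b : Sa s -> posroot D b ->
  (`|vfloor v b| < `|vfloor (v * s)%g b|)%N -> ell (v * s)%g = (ell v).+1.
Proof.
move=> /(Sa_cross v)[a [m [ap _ E [[_ L]|[lt L]]]]] bp; first by rewrite /ell L addn1.
by have [->|ba] := eqVneq b a; [lia|rewrite E //; lia].
Qed.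

Lemma ell_down v s b : Sa s -> posroot D b ->
  (`|vfloor (v * s)%g b| < `|vfloor v b|)%N -> ell v = (ell (v * s)%g).+1.
Proof.
move=> /(Sa_cross v)[a [m [ap _ E [[lt L]|[_ L]]]]] bp; last by rewrite /ell L addn1.
by have [->|ba] := eqVneq b a; [lia|rewrite E //; lia].
Qed.

Lemma ell1 : ell (1%g : wext D) = 0%N.
Proof. exact: sepw1. Qed.

Lemma ell_omega v g : Omega g -> ell (v * g)%g = ell v.
Proof. exact: sepw_omega. Qed.

Lemma wsum_const1 k : wsum (fun=> 1%N) k = `|k|%N.
Proof. by case: k => p; rewrite /= sum1_card card_ord. Qed.

Lemma ell0_omega v : ell v = 0%N -> Omega v.
Proof.
move=> /eqP; rewrite sum_nat_seq_eq0 => /allP v0; apply/omega_alc/vfloor_alc => a ap.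
have := v0 a; rewrite mem_posroots => /(_ (introT (posbP _ _) ap)) /=.
rewrite wsum_const1 absz_eq0 => /eqP ->.
by rewrite vfloor1 (introT (posbP _ _) ap).
Qed.

(** The point v^-1([base_point]) is outside A_f, hence beyond one of its walls; v carries this wall
    to one that separates A_v from the base point of A_f. *)
Lemma ell_descent v : ell v <> 0%N ->
  exists2 s, Sa s & ell v = (ell (v * s)%g).+1.
Proof.
move=> v0; pose x : 'cV[R]_n := act v^-1%g (base_point R D).
have xE : act v x = base_point R D by rewrite actKV.
have xA : ~ Af x.
  move=> xA; apply: v0; rewrite -ell1; apply: sepw_eq => a ap.
  have aR := posroot_root ap.
  have /alcP/(_ a aR) : alc v (base_point R D) by exists x.
  have := alc_point_bounds R (1%g : wext D) aR; rewrite /alc_point act1.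
  move=> /andP[h1 h2] /andP[h3 h4].
  have := le_lt_trans h3 h2; have := lt_le_trans h1 h4; rewrite !ltr_int.
  by move: (vfloor v a) (vfloor _ a) => k l; clear; lia.
have [b [bR bw bx]] := separating_wall xA.
set m := vfloor 1%g b in bw bx; pose s := aref bR m; have ss : Sa s by exact: Sa_aref.
exists s => //; have [u wi] := weylmx_inv (wextP v).
pose a := b *m invmx (val v).2.
have aR : a \in Phi by exact: root_mul_weyl.
have aE : a *m (val v).2 = b by rewrite mulmxKV.
pose m' := m + pairZ a (val v).1.
have va : vfloor v a = m' by rewrite /vfloor aE /m' /m vfloor1 addrC.
have vsa : vfloor (v * s)%g a = m' - 1.
  rewrite /s (aref_conj _ aR bR aE) vfloor_aref va -/m'; clear; lia.
have am : pairR a (base_point R D) < m'%:~R.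
  by rewrite -xE pairR_act aE /m' intrD addrC ltrD2r.
have [ap|an] := root_sign aR.
  have /andP[a0 _] := base_point_pos R ap.
  apply: (ell_down ss ap); rewrite va vsa.
  by have := lt_trans a0 am; rewrite ltr0z; clear; lia.
have /andP[_ a1] := base_point_pos R an.
apply: (ell_down ss an); rewrite !vfloor_opp // va vsa.
have : (- 1)%:~R < m'%:~R :> R by apply: lt_trans am; move: a1; rewrite pairRNl; lra.
by rewrite ltr_int; clear; lia.
Qed.

Lemma ell_prod v ts : (forall s, s \in ts -> Sa s) ->
  (ell (v * \prod_(s <- ts) s)%g <= ell v + size ts)%N /\
  odd (ell (v * \prod_(s <- ts) s)%g) = odd (ell v + size ts).
Proof.
elim: ts v => [|s ts IHts] v tsS; first by rewrite big_nil mulg1 addn0.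
have [|le od] := IHts (v * s)%g; first by move=> u us; apply: tsS; rewrite inE us orbT.
rewrite big_cons mulgA /=; have [E|E] := ell_Sa v (tsS s (mem_head _ _)).
  by rewrite addnS -addSn -E.
rewrite E addSn addnS od /= negbK; split=> //.
by apply: leq_trans le _; clear; lia.
Qed.

Lemma word_ell v ts : word R v ts -> (ell v <= size ts)%N /\ odd (ell v) = odd (size ts).
Proof.
move=> [tsS [g og ->]]; rewrite ell_omega //.
by have := ell_prod 1%g tsS; rewrite mul1g ell1.
Qed.

Lemma word_exists v : exists2 ts, word R v ts & size ts = ell v.
Proof.
have [k] := ubnP (ell v); elim: k v => // k IHk v vk.
have [v0|v0] := eqVneq (ell v) 0%N.
  exists [::]; rewrite ?v0 //; split=> //; exists v; first exact: ell0_omega.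
  by rewrite big_nil mul1g.
have [s ss vs] := ell_descent (elimN eqP v0).
have [|ts [tsS [g og E]] tsz] := IHk (v * s)%g; first by move: vk vs; clear; lia.
(* The element of Omega must stay last, so s is moved past g and becomes its conjugate. *)
exists (rcons ts (g * s * g^-1)%g); last by rewrite size_rcons tsz vs.
split=> [u|].
  by rewrite mem_rcons inE => /predU1P[->|/tsS//]; exact: Sa_omega.
exists g => //; rewrite -cats1 big_cat big_seq1 /= !mulgA mulgVK -E.
by rewrite -mulgA (Sa_invol ss) mulg1.
Qed.

Lemma redwordP v : reduced_word R v (redword R v).
Proof.
rewrite /redword; apply: xgetPex; have [ts wts tsz] := word_exists v.
by exists ts; split=> // us /word_ell[]; rewrite tsz.
Qed.

Lemma lenE v : len R v = ell v.
Proof.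
have [wv min] := redwordP v; have [ts wts tsz] := word_exists v.
by apply/eqP; rewrite eqn_leq -{1}tsz min //=; have [] := word_ell wv.
Qed.

End LengthFunction.

(** * Weights of hyperplanes and the exponents of q *)

Section Weights.
Variables (R : realType) (n : nat) (D : rootDatum n).
Variables (d : wext D -> nat) (hd : conj_invariant R d).
Implicit Types (a b : 'rV[int]_n) (v w s g : wext D).
Implicit Types (ts us : seq (wext D)).
Local Notation Phi := (Defs.roots D).

(* Independent of the chosen s, since d is invariant under conjugation. *)
Definition hypw a (m : int) : nat :=
  d (xget 1%g [set s | Sa R s /\ exists v,
    val (v * s * v^-1)%g = (m *: coroot D a, Defs.refl D a)]).

Lemma hypwE a m v s : Sa R s ->
  val (v * s * v^-1)%g = (m *: coroot D a, Defs.refl D a) -> hypw a m = d s.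
Proof.
move=> ss E; rewrite /hypw; case: xgetP => [s' _ [ss' [v' E']]|/(_ s)[]]; last first.
  by split=> //; exists v.
have {E} : (v * s * v^-1 = v' * s' * v'^-1)%g by apply/val_inj; rewrite E E'.
move=> E; apply: (hd (v := (v'^-1 * v)%g) ss ss').
transitivity (v'^-1 * (v * s * v^-1) * v')%g; last by rewrite invgM invgK !mulgA.
by rewrite E !mulgA mulVg mul1g mulgVK.
Qed.

(** Conjugation by w shows that both sides choose from the same set of generators, so they agree
    whatever is chosen, default included. *)
Lemma hypw_conj a b m j : (exists w : wext D, forall r : wext D,
    val r = (m *: coroot D a, Defs.refl D a) <->
    val (w * r * w^-1)%g = (j *: coroot D b, Defs.refl D b)) -> hypw a m = hypw b j.
Proof.
move=> [w wr]; rewrite /hypw; congr (d (xget _ _)); apply/seteqP.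
split=> s [ss [v E]]; split=> //.
  exists (w * v)%g; move/wr: E; by rewrite invgM !mulgA.
exists (w^-1 * v)%g; apply/wr; rewrite -E; congr val.
by rewrite invgM invgK !mulgA mulgV mul1g mulgK.
Qed.

Lemma hypw_opp a : a \in Phi -> hypw (- a) 0 = hypw a 0.
Proof.
by move=> aR; apply: hypw_conj; exists 1%g => r; rewrite mul1g invg1 mulg1 !scale0r reflN.
Qed.

Lemma hypw_weyl a M : weylmx D M -> a \in Phi -> hypw (a *m M) 0 = hypw a 0.
Proof.
move=> wM aR; apply: hypw_conj; exists (mkwext 0 wM) => r.
have [u _] := weylmx_inv wM.
have E := refl_conj wM aR; rewrite !scale0r.
split=> [rE|].
  rewrite /= rE /= !mulmx0 oppr0 mulmx0 !addr0.
  by rewrite E mulmxK.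
rewrite [val r]surjective_pairing /= mulmx0 oppr0 mulmx0 addr0 add0r.
case=> h1 h2; congr pair.
  by rewrite -[LHS](mulKmx u) h1 mulmx0.
have := congr1 (fun N => invmx M *m (N *m M)) h2.
by rewrite mulmxKV // -E !mulKmx.
Qed.

Definition wlen v : nat := sepw hypw v.

Lemma wlen_Sa v s : Sa R s -> ell (v * s)%g = (ell v).+1 -> wlen (v * s)%g = (wlen v + d s)%N.
Proof.
move=> ss up; have [a [m [ap vs _ [[_ L]|[_ L]]]]] := Sa_cross v ss.
  by rewrite /wlen L (hypwE ss vs).
have := L (fun _ _ => 1%N); rewrite -/(ell _) -/(ell _) up; clear; lia.
Qed.

Lemma wlen_prod v ts : (forall s, s \in ts -> Sa R s) ->
  ell (v * \prod_(s <- ts) s)%g = (ell v + size ts)%N ->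
  wlen (v * \prod_(s <- ts) s)%g = (wlen v + \sum_(s <- ts) d s)%N.
Proof.
elim: ts v => [|s ts IHts] v tsS; first by rewrite !big_nil mulg1 addn0.
have tsS' u : u \in ts -> Sa R u by move=> us; apply: tsS; rewrite inE us orbT.
have ss := tsS s (mem_head _ _).
rewrite !big_cons mulgA /= => E.
have up : ell (v * s)%g = (ell v).+1.
  have [le _] := ell_prod (v * s)%g tsS'; have := ell_Sa v ss.
  by move: E le; move: (ell _) (ell _) (ell _) => a b c; clear; lia.
by rewrite IHts // ?wlen_Sa ?addnA // E up addnS addSn.
Qed.

Lemma wlen_word v ts : word R v ts -> size ts = ell v -> (\sum_(s <- ts) d s)%N = wlen v.
Proof.
move=> [tsS [g og vE]] tsz.
have := wlen_prod (v := 1%g) tsS; rewrite mul1g ell1 add0n /wlen sepw1 add0n => <-.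
  by rewrite vE (sepw_omega _ _ og).
by rewrite tsz vE (ell_omega _ og).
Qed.

Lemma wlen_redword v : (\sum_(s <- redword R v) d s)%N = wlen v.
Proof. by have [wv _] := redwordP R v; apply: wlen_word wv _; rewrite -(lenE R). Qed.

Lemma wlen_mul v w : ell (v * w)%g = (ell v + ell w)%N -> wlen (v * w)%g = (wlen v + wlen w)%N.
Proof.
have [ts [tsS [g og wE]] tsz] := word_exists R w => E.
rewrite -(@wlen_word w ts) //; last by split=> //; exists g.
move: E; rewrite -tsz wE mulgA (ell_omega _ og) /wlen (sepw_omega _ _ og).
exact: wlen_prod.
Qed.

Lemma qwE v : qw R d v = q ^+ wlen v.
Proof. by rewrite -wlen_redword (big_morph _ (exprD q) (expr0 q)). Qed.

Lemma qdomE x : qdom R d x = qhalf ^+ wlen (transl D x).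
Proof. by rewrite -wlen_redword (big_morph _ (exprD qhalf) (expr0 qhalf)). Qed.

End Weights.

(** * Lengths in the Weyl group and in the dominant chamber *)

Lemma wsum_bool (f : int -> nat) (b : bool) :
  wsum f (- (b : nat)%:Z) = (b * f 0%R)%N.
Proof.
case: b; first by rewrite /= big_ord_recr big_ord0 /= oppr0 add0n mul1n.
by have -> : - (false : nat)%:Z = Posz 0 by []; rewrite /= big_ord0.
Qed.

Section WeylLength.
Variables (R : realType) (n : nat) (D : rootDatum n).
Implicit Types (a b : 'rV[int]_n) (v w u s g : wext D) (f : 'rV[int]_n -> int -> nat).
Implicit Types (x : 'cV[int]_n) (M : 'M[int]_n).
Local Notation Phi := (Defs.roots D).
Local Notation Sa := (Sa R).

Lemma weylM v w : weyl D v -> weyl D w -> weyl D (v * w)%g.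
Proof. by move=> v0 w0; rewrite /weyl /= v0 w0 mulmx0 addr0. Qed.

Lemma weylV w : weyl D w -> weyl D w^-1%g.
Proof. by move=> w0; rewrite /weyl /= w0 mulmx0 oppr0. Qed.

Lemma weyl_inj v w : weyl D v -> weyl D w -> (val v).2 = (val w).2 -> v = w.
Proof.
by move=> v0 w0 E; apply/val_inj; rewrite [LHS]surjective_pairing E v0 -w0 -surjective_pairing.
Qed.

Definition reflw i : wext D := aref (simple_root i) 0.

Lemma reflw_weyl i : weyl D (reflw i).
Proof. by rewrite /weyl /= scale0r. Qed.

Lemma reflw_Sa i : Sa (reflw i).
Proof. exact/Sa_aref/simple_wall. Qed.

Lemma posb_rho2 a : a \in Phi -> posb D a = (0 < pairZ a (rho2 D)).
Proof.
move=> aR; case: (posbP D a) => [/posroot_rho2->//|an].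
have [//|/posroot_rho2] := root_sign aR; rewrite pairZNl; clear; lia.
Qed.

Lemma weyl_pos_id w : weyl D w ->
  (forall i, posroot D (simple D i *m (val w).2)) -> w = 1%g.
Proof.
by move=> w0 wp; apply: weyl_inj => //; apply: weyl_id => //; exact: wextP.
Qed.

Lemma vfloor_weyl w a : weyl D w -> vfloor w a = - (~~ posb D (a *m (val w).2) : nat)%:Z.
Proof. by rewrite /vfloor => ->; rewrite pairZ0r sub0r. Qed.

Lemma weyl_down w i : weyl D w ->
  ~ posroot D (simple D i *m invmx (val w).2) -> ell w = (ell (w * reflw i)%g).+1.
Proof.
move=> w0 ni; have [u wi] := weylmx_inv (wextP w).
have iR := simple_root i.
have aR := root_mul_weyl wi iR.
set a := - (simple D i *m invmx (val w).2).
have ap : posroot D a by have [/ni//|] := root_sign aR.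
have aw : a *m (val w).2 = - simple D i by rewrite mulNmx mulmxKV.
have sp := introT (posbP D _) (simple_pos i).
apply: (ell_down (reflw_Sa i) ap); rewrite !vfloor_weyl //; last first.
  exact: weylM (reflw_weyl i).
by rewrite /= mulmxA aw mulNmx mulmx_refl_id // opprK posbN // sp.
Qed.

Lemma weyl_descent w : weyl D w -> w <> 1%g ->
  exists i, ell w = (ell (w * reflw i)%g).+1.
Proof.
move=> w0 w1; have [i ni] : exists i, ~ posroot D (simple D i *m invmx (val w).2).
  apply: contrapT => no; apply: w1; rewrite -[w]invgK.
  rewrite (@weyl_pos_id w^-1%g) ?invg1 //; first exact: weylV.
  by move=> i; apply: contrapT => ni; apply: no; exists i.
by exists i; apply: weyl_down.
Qed.

(** The form in which the longest element is used: it reverses the sign of every root. *)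
Definition neg_all w := forall a, a \in Phi -> posb D (a *m (val w).2) = ~~ posb D a.

Lemma neg_allV w : neg_all w -> neg_all w^-1%g.
Proof.
move=> wn b bR; have [u wi] := weylmx_inv (wextP w).
by rewrite /= -[b in RHS](mulmxKV u) wn ?negbK //; apply: root_mul_weyl.
Qed.

(** If alpha_i w^-1 were positive, w s_i would be longer than w. So w^-1 makes all simple roots
    negative, and with them all positive roots. *)
Lemma longest_neg_all w : longest R w -> neg_all w.
Proof.
move=> [w0 max]; rewrite -[w]invgK; apply: neg_allV.
have [u wi] := weylmx_inv (wextP w).
have ni i : ~ posroot D (simple D i *m invmx (val w).2).
  move=> ap; have iR := simple_root i.
  have sp := introT (posbP D _) (simple_pos i).
  have := max _ (weylM w0 (reflw_weyl i)); rewrite !lenE.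
  rewrite (ell_up (reflw_Sa i) ap) ?ltnn // !vfloor_weyl //; last first.
    exact: weylM (reflw_weyl i).
  by rewrite /= mulmxA mulmxKV // mulmx_refl_id // posbN // sp.
have np a : posroot D a -> posb D (a *m invmx (val w).2) = false.
  move=> [aR [c cE]]; rewrite posb_rho2; last exact: root_mul_weyl.
  rewrite cE mulmx_suml pairZ_suml; apply/negbTE; rewrite -leNgt.
  apply: sumr_le0 => i _; rewrite -scaler_nat -scalemxAl pairZZl.
  rewrite natz; apply: mulr_ge0_le0 => //.
  have iR := root_mul_weyl wi (simple_root i).
  by rewrite leNgt -posb_rho2 //; apply/posbP/ni.
move=> a aR /=; case: (posbP D a) => [/np->//|an] /=.
have [//|/np] := root_sign aR.
by rewrite mulNmx posbN; [move/negbFE|apply: root_mul_weyl].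
Qed.

(** Only m = 0 matters: for w in W the alcove of A_w contains the origin, so the hyperplanes
    separating it from A_f pass through the origin. *)
Definition weyl_stable f := forall a M, a \in Phi -> weylmx D M ->
  f (- a) 0 = f a 0 /\ f (a *m M) 0 = f a 0.

Lemma sepw_weyl f w : weyl D w ->
  sepw f w = (\sum_(a <- posroots D) (posb D a (+) posb D (a *m (val w).2)) * f a 0%R)%N.
Proof.
move=> w0; apply: eq_big_seq => a; rewrite mem_posroots => ap.
by rewrite vfloor_weyl // ap wsum_bool.
Qed.

Lemma sepw_weylV f w : weyl_stable f -> weyl D w -> sepw f w^-1%g = sepw f w.
Proof.
move=> fs w0; rewrite !sepw_weyl //; last exact: weylV.
have wM := wextP w; have [u wi] := weylmx_inv wM.
pose F b := ((posb D b (+) posb D (b *m (val w).2)) * f b 0%R)%N.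
rewrite -[RHS](@sum_posroots_weyl _ _ _ F wi) => [|a aR]; last first.
  rewrite /F mulNmx !posbN //; last exact: root_mul_weyl.
  by have [-> _] := fs a _ aR wM; case: posb; case: posb.
apply: eq_big_seq => a; rewrite mem_posroots => /posb_root aR.
by rewrite /F mulmxKV // addbC; have [_ ->] := fs a _ aR wi.
Qed.

(** As v reverses all signs, the roots inverted by v w correspond under v, up to sign, to those that
    w does not invert; with the inversions of w they exhaust the positive roots. *)
Lemma sepw_longest f w v : weyl_stable f -> weyl D w -> weyl D v -> neg_all v ->
  (sepw f (v * w)%g + sepw f w)%N = sepw f v.
Proof.
move=> fs w0 v0 vn; rewrite !sepw_weyl //; last exact: weylM.
have wM := wextP w; have vM := wextP v.
pose F b := ((~~ (posb D b (+) posb D (b *m (val w).2))) * f b 0%R)%N.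
transitivity (\sum_(a <- posroots D) F a +
   \sum_(a <- posroots D) (posb D a (+) posb D (a *m (val w).2)) * f a 0%R)%N.
  congr (_ + _)%N; rewrite -[RHS](@sum_posroots_weyl _ _ _ F vM) => [|a aR]; last first.
    rewrite /F mulNmx !posbN //; last exact: root_mul_weyl.
    by have [-> _] := fs a _ aR wM; case: posb; case: posb.
  apply: eq_big_seq => a; rewrite mem_posroots => /posb_root aR.
  rewrite /F vn //= mulmxA; have [_ ->] := fs a _ aR vM.
  by case: posb; case: posb.
rewrite -big_split; apply: eq_big_seq => a; rewrite mem_posroots => ap.
rewrite /F vn ?posb_root // ap /=.
by case: posb; rewrite ?mul0n ?mul1n ?addn0.
Qed.

Lemma weyl_stable1 : weyl_stable (fun _ _ => 1%N).
Proof. by []. Qed.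

Lemma ell_weylV w : weyl D w -> ell w^-1%g = ell w.
Proof. exact: sepw_weylV weyl_stable1. Qed.

Definition dominantv v := forall a, posroot D a -> 0 <= vfloor v a.

Lemma transl_mulE x w : weyl D w -> val (transl D x * w)%g = (x, (val w).2).
Proof. by move=> w0; rewrite /= w0 mulmx0 addr0 mul1mx. Qed.

Lemma vfloor_transl x w a : weyl D w ->
  vfloor (transl D x * w)%g a = pairZ a x - (~~ posb D (a *m (val w).2) : nat)%:Z.
Proof. by move=> w0; rewrite /vfloor transl_mulE. Qed.

Lemma vfloor_transl1 x a : posroot D a -> vfloor (transl D x) a = pairZ a x.
Proof. by move=> ap; rewrite /vfloor /= mulmx1 (introT (posbP _ _) ap) subr0. Qed.

Lemma ellE v : ell v = (\sum_(a <- posroots D) `|vfloor v a|)%N.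
Proof. by apply: eq_bigr => a _; rewrite wsum_const1. Qed.

Lemma ell_dominantv x w : weyl D w -> dominantv (transl D x * w)%g ->
  ell (transl D x) = (ell (transl D x * w)%g + ell w)%N.
Proof.
move=> w0 dom; rewrite !ellE -big_split; apply: eq_big_seq => a.
rewrite mem_posroots => /posbP ap; have := dom a ap.
rewrite vfloor_transl1 // vfloor_transl // vfloor_weyl //=.
by case: posb => /=; clear; lia.
Qed.

Lemma translM x y : (transl D x * transl D y)%g = transl D (x + y).
Proof. by apply/val_inj; rewrite /= mul1mx mulmx1. Qed.

Lemma ell_transl x y : dominant D x -> dominant D y ->
  ell (transl D (x + y)) = (ell (transl D x) + ell (transl D y))%N.
Proof.
move=> dx dy; rewrite !ellE -big_split; apply: eq_big_seq => a.
rewrite mem_posroots => /posbP ap; rewrite !vfloor_transl1 // pairZDr.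
by have := dx a ap; have := dy a ap; clear; rewrite /=; lia.
Qed.

Lemma stab_transl x u : stab D x u -> (u * transl D x = transl D x * u)%g.
Proof.
move=> [u0 ux]; apply/val_inj; rewrite transl_mulE // /= u0 add0r mulmx1.
by congr pair; rewrite -{2}ux /actZ u0 add0r.
Qed.

Lemma stab_pair x u a : stab D x u -> pairZ (a *m (val u).2) x = pairZ a x.
Proof. by move=> [u0 ux]; rewrite pairZ_mulmx -{2}ux /actZ u0 add0r. Qed.

Lemma stab_neg x u a : dominant D x -> stab D x u -> posroot D a ->
  posb D (a *m (val u).2) = false -> pairZ a x = 0.
Proof.
move=> dx ux ap an; have aR := wext_root u (posroot_root ap).
have : posroot D (- (a *m (val u).2)) by apply/posbP; rewrite posbN // an.
move=> /dx; rewrite pairZNl (stab_pair _ ux); have := dx a ap; clear; lia.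
Qed.

(** An inversion of u pairs to 0 with x, so its floor becomes -1 and adds to the length; the other
    floors are those of the translation. *)
Lemma ell_stab_transl x u : dominant D x -> stab D x u ->
  ell (transl D x * u)%g = (ell (transl D x) + ell u)%N.
Proof.
move=> dx ux; have [u0 _] := ux.
rewrite !ellE -big_split; apply: eq_big_seq => a.
rewrite mem_posroots => /posbP ap; rewrite vfloor_transl1 // vfloor_transl // vfloor_weyl //=.
have := stab_neg dx ux ap; have := dx a ap.
by case: posb => /= h; [clear; lia | move=> /(_ erefl) ->].
Qed.

(* The inversions of u w are those of u and the u-translates of those of w;
   an inversion of u lies in a hyperplane through x, where w has none. *)
Lemma ell_stab_dominantv x u w : dominant D x -> stab D x u -> weyl D w ->
  dominantv (transl D x * w)%g -> ell (u * w)%g = (ell u + ell w)%N.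
Proof.
move=> dx ux w0 dom; have [u0 _] := ux.
rewrite /ell (sepw_weyl _ u0) (sepw_weyl _ w0) (sepw_weyl _ (weylM u0 w0)).
pose F b := ((posb D b (+) posb D (b *m (val w).2)) * 1)%N.
rewrite -[X in (_ + X)%N](@sum_posroots_weyl _ _ _ F (wextP u)) => [|a aR]; last first.
  rewrite /F mulNmx !posbN //; last exact: wext_root.
  by case: posb; case: posb.
rewrite -big_split; apply: eq_big_seq => a; rewrite mem_posroots => ap'.
have /posbP ap := ap'; rewrite /F ap' /= mulmxA.
case E : (posb D (a *m (val u).2)) => /=; first by rewrite !muln1.
have aR := wext_root u (posroot_root ap).
have bp : posroot D (- (a *m (val u).2)) by apply/posbP; rewrite posbN // E.
have := dom _ bp; rewrite vfloor_transl // pairZNl (stab_pair _ ux) (stab_neg dx ux ap E).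
rewrite mulNmx posbN; last exact: wext_root aR.
by rewrite /=; case: posb.
Qed.

(** Floors are not additive, so the argument passes through an interior point: positive roots are
    nonnegative there, which forces their floors above -1. *)
Lemma dominantv_simple v : (forall i, 0 <= vfloor v (simple D i)) -> dominantv v.
Proof.
move=> h a ap; have [_ [c cE]] := ap.
have /andP[_] := alc_point_bounds R v (posroot_root ap).
have a0 : 0 <= pairR a (alc_point R v).
  rewrite cE pairR_suml; apply: sumr_ge0 => i _.
  rewrite pairRMnl mulrn_wge0 //.
  have /andP[/ltW + _] := alc_point_bounds R v (simple_root i).
  by apply: le_trans; rewrite ler0z.
by move=> /(le_lt_trans a0); rewrite ltr0z; clear; lia.
Qed.

Lemma stabM x u v : stab D x u -> stab D x v -> stab D x (u * v)%g.
Proof.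
move=> [u0 ux] [v0 vx]; split; first exact: weylM.
move: ux vx; rewrite /actZ u0 v0 /= u0 v0 mulmx0 !add0r => ux vx.
by rewrite -mulmxA vx ux.
Qed.

Lemma stab_reflw x i : pairZ (simple D i) x = 0 -> stab D x (reflw i).
Proof.
move=> ix; split; first exact: reflw_weyl.
by rewrite /actZ /= scale0r add0r refl_mulmx ix scale0r subr0.
Qed.

(* In a coset W_x w take an element of minimal length. *)
Lemma stab_dominantv_exists x w : dominant D x -> weyl D w ->
  exists u v, [/\ stab D x u, weyl D v, dominantv (transl D x * v)%g & w = (u * v)%g].
Proof.
move=> dx; have [k] := ubnP (ell w); elim: k w => // k IHk w wk w0.
have [dom|] := pselect (dominantv (transl D x * w)%g).
  exists 1%g, w; rewrite mul1g; split=> //; split=> //.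
  by rewrite /actZ /= add0r mul1mx.
move=> ndom; have [i] : exists i, vfloor (transl D x * w)%g (simple D i) < 0.
  apply: contrapT => no; apply/ndom/dominantv_simple => i.
  by rewrite leNgt; apply/negP => ni; apply: no; exists i.
have ip := simple_pos i; have := dx _ ip; rewrite vfloor_transl //.
case E : posb => /= h1 h2; first by exfalso; move: h1 h2; clear; lia.
(* A negative floor of alpha_i at a dominant x means that alpha_i pairs to 0 with x and alpha_i w is
   negative: s_i fixes x and shortens w from the left. *)
have {h1 h2}ix : pairZ (simple D i) x = 0 by move: h1 h2; clear; lia.
have L : ell w^-1%g = (ell (w^-1 * reflw i)%g).+1.
  apply: weyl_down; first exact: weylV.
  by rewrite /= invmxK; move=> /posbP; rewrite E.
have sw : weyl D (reflw i * w)%g by apply: weylM => //; apply: reflw_weyl.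
have [|u [v [ux v0 dom wE]]] := IHk _ _ sw.
  rewrite -(ell_weylV sw) invgM (Sa_inv (reflw_Sa i)) -ltnS -L.
  by rewrite (ell_weylV w0).
exists (reflw i * u)%g, v; split=> //; first exact/stabM/ux/stab_reflw.
by rewrite -mulgA -wE mulgA (Sa_invol (reflw_Sa i)) mul1g.
Qed.

(** As u commutes with the translation by x, it maps the first dominant alcove onto the second.
    Positive roots are positive inside both, so u makes no simple root negative. *)
Lemma dominantv_inj x u w : stab D x u -> weyl D w ->
  dominantv (transl D x * w)%g -> dominantv (transl D x * (u * w))%g -> u = 1%g.
Proof.
move=> ux w0 dw duw; have [u0 _] := ux.
have pos v a : dominantv v -> posroot D a -> 0 < pairR a (alc_point R v).
  move=> dom ap; have /andP[+ _] := alc_point_bounds R v (posroot_root ap).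
  by apply: le_lt_trans; rewrite ler0z; apply: dom.
apply: weyl_pos_id => // i; have iR := simple_root i.
have [//|an] := root_sign (wext_root u iR).
have := pos _ _ duw (simple_pos i); have := pos _ _ dw an.
rewrite mulgA -(stab_transl ux) -mulgA /alc_point [act (u * _)%g _]actM.
by rewrite [in X in _ -> X -> _]pairR_act u0 pairZ0r add0r pairRNl; lra.
Qed.

End WeylLength.

(** * Alcoves as closures of connected components *)

Section Continuity.
Variables (R : realType) (n : nat).
Local Notation V := 'cV[R]_n.

Lemma continuous_addr (T : topologicalType) (f g : T -> R) :
  continuous f -> continuous g -> continuous (fun x => f x + g x).
Proof. by move=> fc gc x; apply: cvgD; [exact: fc|exact: gc]. Qed.

Lemma continuous_mull (T : topologicalType) c (f : T -> R) :
  continuous f -> continuous (fun x => c * f x).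
Proof. by move=> fc x; apply: cvgM; [exact: cvg_cst|exact: fc]. Qed.

Lemma pairR_continuous (a : 'rV[int]_n) : continuous (@pairR R n a).
Proof.
have -> : @pairR R n a = fun x => \sum_(j < n) (a 0 j)%:~R * x j 0.
  by apply/funext => x; rewrite /pairR mxE; apply: eq_bigr => j _; rewrite mxE.
elim: index_enum => [|j r IHr].
  rewrite (_ : (fun=> _) = fun=> 0); last by apply/funext => x; rewrite big_nil.
  by move=> x; exact: cst_continuous.
rewrite (_ : (fun=> _) = fun x : V => (a 0 j)%:~R * x j 0 +
  \sum_(j <- r) (a 0 j)%:~R * x j 0); last by apply/funext => x; rewrite big_cons.
apply: continuous_addr IHr; apply: continuous_mull.
exact: coord_continuous.
Qed.

Lemma mx_continuous (T : topologicalType) (f : T -> V) :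
  (forall i, continuous (fun t => f t i 0)) -> continuous f.
Proof.
move=> fc t A [P Pt PA].
have F : \forall s \near t, forall i, P i 0 (f s i 0).
  by apply: filter_forall => i; apply: fc; apply: Pt.
by apply: filterS F => s Ps; apply: PA => i j; rewrite (ord1 j).
Qed.

Definition segm (x y : V) (t : R) : V := x + t *: (y - x).

Lemma segm_continuous x y : continuous (segm x y).
Proof.
apply: mx_continuous => i; rewrite /segm.
have -> : (fun t => (x + t *: (y - x)) i 0) = (fun t : R => x i 0 + (y - x) i 0 * t).
  by apply/funext => t; rewrite !mxE [t * _]mulrC.
apply: continuous_addr; first by move=> t; exact: cst_continuous.
by apply: continuous_mull => t; exact: cvg_id.
Qed.

Lemma pairR_segm a x y t : pairR a (segm x y t) = (1 - t) * pairR a x + t * pairR a y.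
Proof. by rewrite /segm pairRDr pairRZr pairRBr; ring. Qed.

End Continuity.

Lemma convex_lt (R : realFieldType) (t x y c : R) :
  0 <= t <= 1 -> c < x -> c < y -> c < (1 - t) * x + t * y.
Proof.
move=> /andP[t0 t1] cx cy; pose m := Num.min x y.
have cm : c < m by rewrite lt_min cx.
apply: (lt_le_trans cm); have mx : m <= x by rewrite ge_min lexx.
have my : m <= y by rewrite ge_min lexx orbT.
have h1 : 0 <= (1 - t) * (x - m) by rewrite mulr_ge0 ?subr_ge0.
have h2 : 0 <= t * (y - m) by rewrite mulr_ge0 ?subr_ge0.
lra.
Qed.

Section Components.
Variables (R : realType) (n : nat) (D : rootDatum n).
Local Notation V := 'cV[R]_n.
Local Notation Phi := (Defs.roots D).
Implicit Types (k : 'rV[int]_n -> int) (x y z : V).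

Definition cell k : set V :=
  [set z | forall a, a \in Phi -> (k a)%:~R < pairR a z < (k a + 1)%:~R].

Definition ccell k : set V :=
  [set z | forall a, a \in Phi -> (k a)%:~R <= pairR a z <= (k a + 1)%:~R].

Lemma cell_regular k : cell k `<=` regular D.
Proof.
move=> z zk h [a [m [aR ->]]] zm; have {}zm : pairR a z = m%:~R := zm.
by have := zk a aR; rewrite zm !ltr_int; clear; lia.
Qed.

(** The image under a root of a connected set of regular points is an interval without integers,
    which confines the set to the cell; conversely the cell is convex. *)
Lemma component_cell k y : cell k y -> connected_component (regular D) y = cell k.
Proof.
move=> yk; apply/seteqP; split=> [z [C [Cy Cr Cc] Cz] a aR|z zk].
  have I : is_interval (@pairR R n a @` C).
    apply/connected_intervalP/connected_continuous_connected => //.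
    exact/continuous_subspaceT/pairR_continuous.
  have Iy : (@pairR R n a @` C) (pairR a y) by exists y.
  have Iz : (@pairR R n a @` C) (pairR a z) by exists z.
  have out m : ~ (@pairR R n a @` C) m%:~R.
    by move=> [u Cu um]; apply: (Cr _ Cu (hyp a m)); first exists a, m.
  have /andP[y1 y2] := yk a aR.
  apply/andP; split; rewrite ltNge; apply/negP => zl.
    by apply: (out (k a)); apply: (I _ _ Iz Iy); rewrite zl ltW.
  by apply: (out (k a + 1)); apply: (I _ _ Iy Iz); rewrite zl andbT ltW.
exists (segm y z @` `[0, 1]); last first.
  exists 1; first by rewrite /= in_itv /= lexx ler01.
  by rewrite /segm scale1r addrC subrK.
split.
- exists 0; first by rewrite /= in_itv /= lexx ler01.
  by rewrite /segm scale0r addr0.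
- move=> u [t]; rewrite /= in_itv /= => /andP[t0 t1] <-.
  apply: (@cell_regular k) => a aR; rewrite pairR_segm.
  have /andP[h1 h2] := yk a aR; have /andP[h3 h4] := zk a aR.
  have t01 : 0 <= t <= 1 by rewrite t0.
  apply/andP; split; first exact: convex_lt.
  rewrite -ltrN2; have := convex_lt t01 (x := - pairR a y) (y := - pairR a z).
  by move=> /(_ (- (k a + 1)%:~R)); rewrite !ltrN2 => /(_ h2 h4); lra.
- apply: connected_continuous_connected; last exact/continuous_subspaceT/segm_continuous.
  by apply/connected_intervalP; exact: interval_is_interval.
Qed.

(** A point of the closed cell is a limit of points of the segment towards y, which lie in the open
    cell. *)
Lemma closure_cell k y : cell k y -> closure (cell k) = ccell k.
Proof.
move=> yk; apply/seteqP; split=> [z zc a aR|z zk B zB].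
  have sub (F : set R) : closed F -> cell k `<=` @pairR R n a @^-1` F -> F (pairR a z).
    move=> Fc kF; have : closed (@pairR R n a @^-1` F).
      by apply: closed_comp => // x _; apply: pairR_continuous.
    by move=> /closure_id Fid; suff : (@pairR R n a @^-1` F) z by [];
      rewrite Fid; apply: closureS zc.
  apply/andP; split.
    by apply: (sub [set r | (k a)%:~R <= r] (@closed_ge _ _)) => x /(_ a aR)/andP[/ltW].
  by apply: (sub [set r | r <= (k a + 1)%:~R] (@closed_le _ _)) => x /(_ a aR)/andP[_ /ltW].
have : nbhs (0 : R) (segm z y @^-1` B).
  by apply: segm_continuous; rewrite /segm scale0r addr0.
move=> /nbhs_ballP[e /= e0 eB].
pose t := Num.min (e / 2) 1.
have t0 : 0 < t by rewrite lt_min ltr01 andbT divr_gt0.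
have t1 : t <= 1 by rewrite ge_min lexx orbT.
have te : t < e by rewrite gt_min; apply/orP; left; lra.
exists (segm z y t); split.
  move=> a aR; rewrite pairR_segm.
  have /andP[h1 h2] := yk a aR; have /andP[h3 h4] := zk a aR.
  by apply/andP; split; nra.
by apply: eB; rewrite /ball /= sub0r normrN gtr0_norm.
Qed.

Lemma alc_ccell (v : wext D) : alc v = ccell (vfloor v).
Proof. by apply/seteqP; split=> x /alcP. Qed.

Lemma alcove_alc (v : wext D) : alcove D (alc v : set V).
Proof.
have ck : cell (vfloor v) (alc_point R v) by move=> a aR; apply: alc_point_bounds.
exists (alc_point R v); first exact: cell_regular ck.
by rewrite (component_cell ck) (closure_cell ck) alc_ccell.
Qed.

(** Reflecting in a simple root that is negative at z permutes the other positive roots, so the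
    number of positive roots negative at z drops by one. *)
Lemma weyl_dominate z : (forall a, a \in Phi -> pairR a z != 0) ->
  exists2 M, weylmx D M & forall a, posroot D a -> 0 < pairR (a *m M) z.
Proof.
move=> zr; suff H c M : weylmx D M ->
    (\sum_(a <- posroots D) (pairR (a *m M) z < 0)%R <= c)%N ->
    exists2 M, weylmx D M & forall a, posroot D a -> 0 < pairR (a *m M) z.
  by apply: H (weylmx1 D) (leqnn _).
elim: c M => [|c IHc] M wM Mc.
  exists M => // a ap; rewrite lt_neqAle eq_sym zr; last first.
    exact: root_mul_weyl (posroot_root ap).
  rewrite leNgt; apply/negP => an; move: Mc; rewrite leqNgt => /negP; apply.
  by rewrite (big_rem a) /= ?an // mem_posroots; apply/posbP.
have [pos|/existsNP[i /negP ni]] := pselect (forall i, 0 <= pairR (simple D i *m M) z).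
  exists M => // a ap; rewrite lt_neqAle eq_sym zr; last first.
    exact: root_mul_weyl (posroot_root ap).
  have [_ [e ->]] := ap; rewrite mulmx_suml pairR_suml; apply: sumr_ge0 => i _.
  by rewrite -scaler_nat -scalemxAl pairRZl mulr_ge0 // natz ler0z.
have iR := simple_root i; have wr := refl_weylmx iR.
apply: (IHc (Defs.refl D (simple D i) *m M)); first exact: weylmxM.
have iin : simple D i \in posroots D by rewrite mem_posroots; apply/posbP/simple_pos.
rewrite -ltNge in ni; move: Mc; rewrite !(big_rem _ iin) /= ni mulmxA mulmx_refl_id //.
rewrite mulNmx pairRNl oppr_lt0 lt_gtF // add0n add1n ltnS.
rewrite -(perm_big _ (refl_simple_perm i)) /= big_map.
rewrite [X in (_ <= c)%N -> (X <= c)%N](_ : _ = \sum_(a <- rem (simple D i) (posroots D))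
  (pairR (a *m Defs.refl D (simple D i) *m M) z < 0)%R)%N //.
by apply: eq_bigr => a _; rewrite mulmxA.
Qed.

(** For y inside A, the floor of a on A is the pairing of a with x, or one less, according to the
    sign of a on y - x. The Weyl element making y - x dominant records all these signs. *)
Lemma alcove_point (A : set V) (x : 'cV[int]_n) : alcove D A -> A (map_mx intr x) ->
  exists2 w, weyl D w & A = alc (transl D x * w)%g.
Proof.
move=> [y yr ->] Ax; pose k a := Num.floor (pairR a y).
have yni a m : a \in Phi -> pairR a y <> m%:~R.
  by move=> aR ym; apply: (yr (hyp a m)) => //; exists a, m.
have yk : cell k y.
  move=> a aR; rewrite floorD1_gt andbT lt_neqAle floor_le andbT.
  by apply/eqP => E; apply: (yni a (k a)).
move: Ax; rewrite (component_cell yk) (closure_cell yk) => xk.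
have [|M wM pos] := @weyl_dominate (y - map_mx intr x).
  move=> a aR; rewrite pairRBr pairR_map subr_eq0; apply/eqP; exact: yni.
have [u wi] := weylmx_inv wM.
have w0 : weyl D (mkwext 0 wi) by [].
exists (mkwext 0 wi) => //; rewrite alc_ccell.
suff E a : a \in Phi -> vfloor (transl D x * mkwext 0 wi)%g a = k a.
  by apply/seteqP; split=> z zk a aR; have := zk a aR; rewrite E.
move=> aR; rewrite vfloor_transl //=.
have bR := root_mul_weyl wi aR; set b := a *m invmx M in bR *.
have aE : b *m M = a by rewrite mulmxKV.
have := xk a aR; rewrite pairR_map !ler_int.
have /andP[] := yk a aR; case: (posbP D b) => [bp|bn].
  have := pos _ bp; rewrite aE pairRBr pairR_map subr_gt0 => h1 _ h2.
  by have := lt_trans h1 h2; rewrite ltr_int /=; clear; lia.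
have [//|bp] := root_sign bR.
have := pos _ bp; rewrite mulNmx aE pairRNl oppr_gt0 pairRBr pairR_map subr_lt0 => h1 h2 _.
by have := lt_trans h2 h1; rewrite ltr_int /=; clear; lia.
Qed.

End Components.

(** * Generalized alcoves *)

Section GeneralizedAlcoves.
Variables (R : realType) (n : nat) (D : rootDatum n).
Implicit Types (a b : 'rV[int]_n) (v w u s g : wext D) (x : 'cV[int]_n).
Local Notation Phi := (Defs.roots D).
Local Notation Sa := (Sa R).
Local Notation Omega := (Omega R).
Local Notation galc_of := (@galc_of R n D).

Definition linpart v : wext D := mkwext 0 (wextP v).

Lemma linpart_weyl v : weyl D (linpart v).
Proof. by []. Qed.

Lemma transl_linpart v : (transl D (val v).1 * linpart v)%g = v.
Proof.
by apply/val_inj; rewrite transl_mulE // [RHS]surjective_pairing.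
Qed.

Lemma linpart_transl x w : weyl D w -> linpart (transl D x * w)%g = w.
Proof. by move=> w0; apply: weyl_inj => //=; rewrite mul1mx. Qed.

Lemma galc_ofE v : galc_of v = (alc v, (val v).1).
Proof. by rewrite /Defs.galc_of /actZ mulmx0 addr0. Qed.

(** The alcove fixes v up to Omega; with equal weights, w^-1 v also fixes the origin, and an element
    of W preserving A_f makes no root change sign. *)
Lemma galc_of_inj : injective galc_of.
Proof.
move=> v w; rewrite !galc_ofE => -[vw v1].
have E : alc (w^-1 * v)%g = alc (1%g : wext D) :> set 'cV[R]_n.
  by rewrite alcM vw -alcM mulVg.
suff : (w^-1 * v)%g = 1%g by move=> h; rewrite -[LHS](mulVKg w) h mulg1.
have w0 : weyl D (w^-1 * v)%g by rewrite /weyl /= v1 addNr.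
apply: weyl_pos_id => // i; have ip := simple_pos i; apply/posbP.
have := alc_vfloor E (posroot_root ip); rewrite vfloor_weyl // vfloor1 (introT (posbP _ _) ip).
by case: posb.
Qed.

Lemma wt_galc v : wt (galc_of v) = (val v).1.
Proof. by rewrite galc_ofE. Qed.

Lemma delta_galc v : delta D (galc_of v) = linpart v.
Proof.
rewrite /delta wt_galc; case: xgetP => [w _ [w0 E]|/(_ (linpart v))[]]; last first.
  by split; rewrite ?transl_linpart.
have /galc_of_inj vE := E; apply: weyl_inj => //=.
by rewrite [in RHS]vE transl_mulE.
Qed.

Lemma ract_galc v u : ract (galc_of v) u = galc_of (v * u)%g.
Proof. by rewrite /ract delta_galc wt_galc transl_linpart. Qed.

Lemma galcoves_galc v : galcoves D (galc_of v).
Proof.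
rewrite galc_ofE; split; first exact: alcove_alc.
exists 0; last by rewrite /act mulmx0 addr0.
by move=> a _; rewrite /pairR mulmx0 mxE lexx ler01.
Qed.

Lemma galcovesP A : galcoves D A -> exists v, A = galc_of v.
Proof.
case: A => A x [/= Aa Ax]; have [w w0 ->] := alcove_point Aa Ax.
by exists (transl D x * w)%g; rewrite galc_ofE transl_mulE.
Qed.

Lemma separating_galc v w a m : separating D (galc_of v) (galc_of w) a m <->
  posroot D a /\ (vfloor v a < m <= vfloor w a \/ vfloor w a < m <= vfloor v a).
Proof.
rewrite /separating !galc_ofE /=; split=> -[ap h]; split=> //;
  have aR := posroot_root ap.
  case: h => -[h1 h2]; [left|right].
    by apply/andP; split; [apply/(alc_halfspace_le R v m aR)|apply/(alc_halfspace_ge R w m aR)].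
  by apply/andP; split; [apply/(alc_halfspace_le R w m aR)|apply/(alc_halfspace_ge R v m aR)].
case: h => /andP[h1 h2]; [left|right].
  by split; [apply/(alc_halfspace_le R v m aR)|apply/(alc_halfspace_ge R w m aR)].
by split; [apply/(alc_halfspace_ge R v m aR)|apply/(alc_halfspace_le R w m aR)].
Qed.

Lemma prec_galc v s : prec (galc_of v) s <->
  exists2 a, posroot D a & vfloor v a < vfloor (v * s)%g a.
Proof.
rewrite /prec ract_galc; split=> [[a [m [/separating_galc[ap h] le]]]|[a ap h]].
  exists a => //; move: le; rewrite galc_ofE => /(alc_halfspace_le R v m (posroot_root ap)).
  by move: h; clear; lia.
exists a, (vfloor (v * s)%g a); split.
  by apply/separating_galc; split=> //; left; rewrite h lexx.
by rewrite galc_ofE; apply/(alc_halfspace_le R v _ (posroot_root ap)).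
Qed.

Lemma chamber_galc v : (galc_of v).1 `<=` chamber D <-> dominantv v.
Proof.
rewrite galc_ofE; split=> [h a ap|h x vx a ap].
  apply/(alc_halfspace_ge R v 0 (posroot_root ap)) => x /h; exact.
exact: (iffRL (alc_halfspace_ge R v 0 (posroot_root ap)) (h a ap) x vx).
Qed.

(** One case for each product with T_s. The clause on [chamber_wall] decides whether the fold is
    counted by p_s or by r_s; [StepUp] has none, as a fold there would not be positive. *)
Variant dominant_step_spec v s : Prop :=
| StepUp of prec (galc_of v) s & dominantv (v * s)%g & ell (v * s)%g = (ell v).+1
| StepDown of ~ prec (galc_of v) s & dominantv (v * s)%g &
    ell v = (ell (v * s)%g).+1 &
    ~ (exists a m, separating D (galc_of v) (galc_of (v * s)%g) a m /\
         chamber_wall D (@hyp R n a m))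
| StepOut i of ~ prec (galc_of v) s & ~ dominantv (v * s)%g &
    ell (v * s)%g = (ell v).+1 & (v * s)%g = (reflw i * v)%g &
    exists a m, separating D (galc_of v) (galc_of (v * s)%g) a m /\
         chamber_wall D (@hyp R n a m).

Lemma dominant_step v s : dominantv v -> Sa s -> dominant_step_spec v s.
Proof.
move=> dom ss; have [a [m [ap vsE kE kb]]] := Sa_step v ss.
have ka := dom a ap.
case: kE => -[va vsa].
  apply: StepUp.
  - by apply/prec_galc; exists a => //; rewrite va vsa; clear; lia.
  - move=> b bp; have [->|ba] := eqVneq b a; last by rewrite kb // dom.
    by move: ka; rewrite va vsa; clear; lia.
  - by apply: (ell_up ss ap); move: ka; rewrite va vsa; clear; lia.
have np : ~ prec (galc_of v) s.
  move/prec_galc => [b bp]; have [->|ba] := eqVneq b a.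
    by rewrite va vsa; clear; lia.
  by rewrite kb // ltxx.
have [m0|m0] := ltP 0 m.
  have domvs : dominantv (v * s)%g.
    move=> b bp; have [->|ba] := eqVneq b a; last by rewrite kb // dom.
    by move: m0; rewrite vsa; clear; lia.
  apply: StepDown => //.
    by apply: (ell_down ss ap); move: m0; rewrite va vsa; clear; lia.
  move=> [b [j [/separating_galc[bp h] [i hE]]]].
  have [[bE jE]|[bE _]] := hyp_eq (posroot_root bp) (simple_root i) hE.
    by have := dom b bp; have := domvs b bp; move: h; rewrite jE; clear; lia.
  by apply: (posrootN (simple_pos i)); rewrite -bE.
have {m0 ka}mE : m = 0 by move: m0 ka; rewrite va; clear; lia.
have nd : ~ dominantv (v * s)%g by move/(_ a ap); rewrite vsa mE.
(* Only the floor of a changed; were a not simple, all simple floors would still be nonnegative and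
   vs dominant. *)
have [i ai] : exists i, a = simple D i.
  apply: contrapT => no; apply: nd; apply: (dominantv_simple R) => i.
  rewrite kb; [exact/dom/simple_pos|exact: simple_pos|].
  by apply/eqP => E; apply: no; exists i.
apply: (@StepOut _ _ i) => //.
- by apply: (ell_up ss ap); rewrite va vsa mE.
- rewrite -[LHS](mulgVK v); congr (_ * _)%g; apply/val_inj.
  by rewrite [LHS]vsE mE ai.
- exists a, 0; split; last by exists i; rewrite ai.
  by apply/separating_galc; split=> //; right; rewrite va vsa mE.
Qed.

(** An element of W is determined by its inversions, that is, by a bit vector indexed by the
    positive roots. *)
Lemma finite_weyl : finite_set (weyl D).
Proof.
pose N := size (posroots D).
pose h w : N.-tuple bool := map_tuple (fun a => posb D (a *m (val w).2)) (in_tuple (posroots D)).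
pose k (t : N.-tuple bool) := xget 1%g [set w | weyl D w /\ h w = t].
apply: (@sub_finite_set _ _ (k @` setT)); last exact/finite_image/finite_finset.
move=> w w0; exists (h w) => //; rewrite /k; case: xgetP => [w' _ [w'0 E]|/(_ w)[]//].
have {}E a : posroot D a -> posb D (a *m (val w').2) = posb D (a *m (val w).2).
  move=> ap; have ain : a \in posroots D by rewrite mem_posroots; apply/posbP.
  have := congr1 (fun t : N.-tuple bool => nth false t (index a (posroots D))) E.
  by rewrite /= !(nth_map 0) ?index_mem // !nth_index.
apply: galc_of_inj; rewrite !galc_ofE w0 w'0; congr pair; apply: vfloor_alc => a ap.
by rewrite !vfloor_weyl // E.
Qed.

(** A wall meets A_f, where roots take values between -1 and 1, so m is -1, 0 or 1. Finiteness gives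
    the product in [Cgal] its meaning. *)
Lemma finite_Sa : finite_set (@Defs.Sa R n D).
Proof.
pose k (p : 'rV[int]_n * int) := xget (1%g : wext D)
  [set s | val s = (p.2 *: coroot D p.1, Defs.refl D p.1)].
apply: (@sub_finite_set _ _ (k @` ([set` Phi] `*` [set` [:: -1; 0; 1]]))).
  move=> s [a [m [aR [_ [x [xA xh] _]] sE]]]; exists (a, m).
    split=> //=; have /alcP/(_ a aR) : alc (1%g : wext D) x by rewrite alc1.
    have -> : pairR a x = m%:~R by exact: xh.
    rewrite !ler_int vfloor1 !inE; case: posb => /=; clear; lia.
  rewrite /k; case: xgetP => [s' _ E|/(_ s)/= //]; apply/val_inj.
  by rewrite sE E.
by apply/finite_image/finite_setX => //; exact: finite_fset.
Qed.

Lemma Sa_neq_omega s : Sa s -> ~ Omega s.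
Proof.
move=> ss os; have := ell_Sa 1%g ss; rewrite mul1g ell1.
by have := ell_omega 1%g os; rewrite mul1g ell1 => ->; case.
Qed.

End GeneralizedAlcoves.

(** * Dominant positively folded galleries *)

Section Galleries.
Variables (R : realType) (n : nat) (D : rootDatum n).
Implicit Types (v w u s g : wext D) (t : seq (wext D)) (sigma : seq (galc R n)).
Local Notation Sa := (Defs.Sa R).
Local Notation Omega := (Defs.Omega R).
Local Notation galc_of := (@galc_of R n D).
Local Notation ith := (ith D).

Lemma ith0 A sigma : ith (A :: sigma) 0 = A.
Proof. by []. Qed.

Lemma ithS A sigma i : ith (A :: sigma) i.+1 = ith sigma i.
Proof. by []. Qed.

Definition dgallery v t sigma : Prop :=
  [/\ gallery t sigma, positively_folded t sigma,
      forall A, A \in sigma -> A.1 `<=` chamber D & ith sigma 0 = galc_of v].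

Lemma dgallery_head v t sigma : dgallery v t sigma ->
  exists sigma', sigma = galc_of v :: sigma'.
Proof.
case=> -[]; case: sigma => [//|A sigma'] _ _ _ _ _ h0; exists sigma'.
by rewrite -h0.
Qed.

Lemma dgallery_dominantv v t sigma : dgallery v t sigma -> dominantv v.
Proof.
move=> h; have [sigma' sE] := dgallery_head h; case: h => _ _ dom _.
by apply/(chamber_galc R v)/dom; rewrite sE mem_head.
Qed.

Lemma dgallery_nil v sigma : dominantv v ->
  dgallery v [::] sigma <-> sigma = [:: galc_of v].
Proof.
move=> dom; split=> [h|->].
  have [sigma' sE] := dgallery_head h; case: h => -[sz _ _] _ _ _.
  by move: sz; rewrite sE; case: (sigma').
split=> //; first by split=> // A; rewrite inE => /eqP->; exact: galcoves_galc.
by move=> A; rewrite inE => /eqP->; apply/chamber_galc.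
Qed.

Lemma dgallery_cons v w u t sigma : dominantv v ->
  (Omega u -> w = (v * u)%g) ->
  (Sa u -> w = (v * u)%g \/ w = v /\ ~ prec (galc_of v) u) ->
  dgallery w t sigma -> dgallery v (u :: t) (galc_of v :: sigma).
Proof.
move=> dom wO wS h; have [[sz gal st] pf ch h0] := h.
split=> //.
- split=> [|A|i]; first by rewrite /= sz.
    by rewrite inE => /predU1P[->|/gal//]; apply: galcoves_galc.
  case: i => [|i]; last by rewrite ltnS => it; exact: (st i it).
  move=> _ u'; rewrite ithS h0 ith0 ract_galc.
  split=> [/wO->//|/wS[->|[-> _]]]; [by right|by left].
- move=> [|i] s; last by rewrite ltnS => it; exact: (pf i s it).
  move=> _ ss [us]; rewrite -us in ss *.
  rewrite ithS h0 ith0.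
  move=> /galc_of_inj wv; have [E|[_ np]] := wS ss; last exact: np.
  exfalso; have := ell_Sa v ss; rewrite -E wv; clear; lia.
- move=> A; rewrite inE => /predU1P[->|/ch//]; exact/chamber_galc.
Qed.

Lemma dgallery_consP v u t sigma : dgallery v (u :: t) sigma -> (Sa u \/ Omega u) ->
  exists w sigma', [/\ sigma = galc_of v :: sigma', dgallery w t sigma',
    Omega u -> w = (v * u)%g & Sa u -> w = (v * u)%g \/ w = v /\ ~ prec (galc_of v) u].
Proof.
move=> h uSO; have [sigma' sE] := dgallery_head h; rewrite sE in h *.
case: h => -[sz gal st] pf ch _.
have [stO stS] := st 0%N isT; rewrite ithS ith0 ract_galc in stO stS.
have A0 : ith sigma' 0 \in sigma'.
  by move: sz; case: (sigma') => // B ? _; apply: mem_head.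
have [w wE] : exists w, ith sigma' 0 = galc_of w.
  have /galcovesP[w ->] := gal (ith sigma' 0) (mem_behead (s := _ :: _) A0).
  by exists w.
exists w, sigma'; split=> //.
- split=> //.
  + split=> [|A As|i it]; first by case: sz.
      by apply: gal; rewrite inE As orbT.
    exact: (st i.+1 it).
  + by move=> i s it; apply: (pf i.+1 s it).
  + by move=> A As; apply: ch; rewrite inE As orbT.
- by move=> /stO; rewrite wE => /galc_of_inj.
- move=> su; have := stS su; rewrite wE => -[/galc_of_inj wv|/galc_of_inj]; last by left.
  right; split=> //; apply: (pf 0%N u) => //; split=> //.
  by rewrite ithS wE wv.
Qed.

(** Lists the dominant positively folded galleries from a dominant A_v. Their sum then unfolds along
    t, as does a product of the T_u. *)
Fixpoint dpaths t v : seq (seq (galc R n)) :=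
  if t is u :: t' then
    map (cons (galc_of v))
      (if `[< Omega u >] then dpaths t' (v * u)%g
       else (if `[< dominantv (v * u)%g >] then dpaths t' (v * u)%g else [::]) ++
            (if `[< prec (galc_of v) u >] then [::] else dpaths t' v))
  else [:: [:: galc_of v]].

Lemma dominantv_omega v g : Omega g -> dominantv v -> dominantv (v * g)%g.
Proof.
move=> og dom a ap; rewrite (vfloor_omega v og (posroot_root ap)); exact: dom.
Qed.

Lemma dpathsP t v sigma : gtype R t -> dominantv v ->
  sigma \in dpaths t v <-> dgallery v t sigma.
Proof.
elim: t v sigma => [|u t IHt] v sigma tg dom.
  by rewrite inE (dgallery_nil _ dom); split=> [/eqP|->].
have tg' : gtype R t by move=> w wt; apply: tg; rewrite inE wt orbT.
have uSO := tg u (mem_head _ _).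
split=> [|h].
  rewrite /=; case: asboolP => [ou|nou].
    move=> /mapP[tau taup ->]; have dvu := dominantv_omega ou dom.
    apply: (dgallery_cons (w := (v * u)%g)) => //; last exact/IHt.
    by move=> su; case: (Sa_neq_omega su ou).
  have su : Sa u by case: uSO.
  move=> /mapP[tau + ->]; rewrite mem_cat => /orP[].
    case: asboolP => // dvu taup.
    by apply: (dgallery_cons (w := (v * u)%g)) => //; [left|exact/IHt].
  case: asboolP => // np taup.
  by apply: (dgallery_cons (w := v)) => //; [right|exact/IHt].
have [w [tau [-> hw wO wS]]] := dgallery_consP h uSO.
have dw := dgallery_dominantv hw.
rewrite /=; apply: map_f; case: asboolP => [/wO wE|nou].
  by rewrite -wE; apply/IHt.
have su : Sa u by case: uSO.
rewrite mem_cat; have [wE|[wE np]] := wS su.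
  by rewrite -wE; case: asboolP => // _; apply/orP; left; apply/IHt.
by case: (asboolP (prec _ _)) => // _; apply/orP; right; rewrite -wE; apply/IHt; rewrite ?wE // -wE.
Qed.

Lemma dpaths_uniq t v : gtype R t -> dominantv v -> uniq (dpaths t v).
Proof.
elim: t v => [|u t IHt] v tg dom //=.
have tg' : gtype R t by move=> w wt; apply: tg; rewrite inE wt orbT.
have uSO := tg u (mem_head _ _).
rewrite map_inj_uniq; last by move=> x y [].
case: asboolP => [ou|nou]; first exact/IHt/dominantv_omega.
have su : Sa u by case: uSO.
rewrite cat_uniq; apply/and3P; split.
- by case: asboolP => // dvu; apply: IHt.
- apply/hasPn => tau; case: asboolP => // _ /dpathsP-/(_ tg' dom)[_ _ _ h].
  apply/negP; case: asboolP => // dvu /dpathsP-/(_ tg' dvu)[_ _ _].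
  rewrite h => /galc_of_inj E.
  have := ell_Sa v su; rewrite -E; clear; lia.
- by case: asboolP => // _; apply: IHt.
Qed.

Lemma npos_cons u t (P : nat -> Prop) :
  npos (u :: t) P = (`[< P 0%N >] + npos t (fun i => P i.+1))%N.
Proof.
rewrite /npos -!sum1_card [LHS]big_mkcond [in RHS]big_mkcond big_ord_recl.
by congr (_ + _)%N; rewrite !inE /=; case: asboolP.
Qed.

Variable d : wext D -> nat.

Definition step_weight u v w : laurent :=
  qs d u ^+ (`[< w = (v * u)%g /\ prec (galc_of v) u >] +
     `[< w = v /\ exists a m, separating D (galc_of v) (galc_of (v * u)%g) a m /\
                    chamber_wall D (@hyp R n a m) >]) *
  (qs d u - 1) ^+ `[< w = v /\ ~ exists a m,
     separating D (galc_of v) (galc_of (v * u)%g) a m /\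
     chamber_wall D (@hyp R n a m) >].

Lemma CgalE t sigma : Cgal d t sigma =
  \prod_(s <- fset_set (@Defs.Sa R n D))
    (qs d s ^+ (npos t (pos_direction t sigma s) +
              npos t (chamber_fold t sigma s))
     * (qs d s - 1) ^+ npos t (other_fold t sigma s)).
Proof. exact/fsbig_finite/finite_Sa. Qed.

Lemma Cgal_nil sigma : Cgal d [::] sigma = 1.
Proof.
have n0 (P : nat -> Prop) : npos (D := D) [::] P = 0%N by rewrite /npos eq_card0 // => -[].
by rewrite CgalE big1 // => s _; rewrite !n0 !expr0 mulr1.
Qed.

Lemma Cgal_cons u t v w sigma : ith sigma 0 = galc_of w ->
  Cgal d (u :: t) (galc_of v :: sigma) =
  (if `[< Sa u >] then step_weight u v w else 1) * Cgal d t sigma.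
Proof.
move=> h0; rewrite !CgalE.
(* [Cgal] is indexed by generators, not by positions; the weight of the first letter is therefore
   written as a product whose only nontrivial factor is at u. *)
pose F s := if s == u then step_weight u v w else 1.
have -> : (if `[< Sa u >] then step_weight u v w else 1) =
    \prod_(s <- fset_set (@Defs.Sa R n D)) F s.
  case: asboolP => su.
    have uin : u \in fset_set (@Defs.Sa R n D) by rewrite in_fset_set ?inE //; exact: finite_Sa.
    rewrite (big_fsetD1 _ uin) /= {1}/F eqxx big1_seq ?mulr1 // => s.
    by rewrite in_fsetD1 /F => /andP[_ /andP[/negPf->]].
  rewrite big1_seq // => s /andP[_]; rewrite in_fset_set ?inE; last exact: finite_Sa.
  by rewrite /F; case: eqP => // -> /su.
rewrite -big_split; apply: eq_bigr => s _ /=; rewrite !npos_cons /F.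
have -> : `[< pos_direction (u :: t) (galc_of v :: sigma) s 0 >] =
    (s == u) && `[< w = (v * s)%g /\ prec (galc_of v) s >].
  apply/asboolP/andP => [[us]|[/eqP us /asboolP[wE p]]].
    rewrite ithS h0 ith0 ract_galc.
    by move=> /galc_of_inj wE p; split; [apply/eqP|apply/asboolP].
  split=> //; rewrite ithS h0 ith0 ract_galc.
  by rewrite wE.
have foldE : fold (u :: t) (galc_of v :: sigma) s 0 <-> s = u /\ w = v.
  rewrite /fold ithS h0 ith0.
  by split=> [[us /galc_of_inj wv]|[-> ->]].
pose cs := exists a m, separating D (galc_of v) (galc_of (v * s)%g) a m /\
     chamber_wall D (@hyp R n a m).
have cfE : chamber_fold (u :: t) (galc_of v :: sigma) s 0 <-> (s = u /\ w = v) /\ cs.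
  rewrite /chamber_fold ith0 ract_galc.
  by split=> -[/foldE].
have -> : `[< chamber_fold (u :: t) (galc_of v :: sigma) s 0 >] =
    (s == u) && `[< w = v /\ cs >].
  apply/asboolP/andP => [/cfE[[su wv] c]|[/eqP su /asboolP[wv c]]].
    by split; [apply/eqP|apply/asboolP].
  exact/cfE.
have -> : `[< other_fold (u :: t) (galc_of v :: sigma) s 0 >] =
    (s == u) && `[< w = v /\ ~ cs >].
  apply/asboolP/andP => [[/foldE[su wv] c]|[/eqP su /asboolP[wv c]]].
    by split; [apply/eqP|apply/asboolP; split=> // cc; apply/c/cfE].
  by split; [exact/foldE|move=> /cfE[_]].
have [su|_] := eqVneq s u; last by rewrite /= !add0n mul1r.
by rewrite /= /step_weight /cs su addnACA exprD [X in _ * X]exprD mulrACA.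
Qed.

End Galleries.

(** * The Hecke algebra *)

Lemma q_unit : q \is a GRing.unit.
Proof. by rewrite unitrX // qhalf_unit. Qed.

Section Hecke.
Variables (R : realType) (n : nat) (D : rootDatum n).
Variables (d : wext D -> nat) (hd : conj_invariant R d) (H : heckeAlgebra R d).
Implicit Types (v w u s g : wext D) (x : 'cV[int]_n) (t : seq (wext D)).
Local Notation Sa := (Defs.Sa R).
Local Notation Omega := (Defs.Omega R).
Local Notation Dw := (wlen R d).
Local Notation T := (T H).
Local Notation W := (fset_set (weyl D)).

Lemma qX_unit k : q ^+ k \is a GRing.unit.
Proof. by rewrite unitrX // q_unit. Qed.

Lemma TM v w : ell (v * w)%g = (ell v + ell w)%N -> T v * T w = T (v * w)%g.
Proof. by move=> E; apply: T_mul; rewrite !lenE. Qed.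

Lemma T_one : T 1%g = 1.
Proof.
have E h : T 1%g * h = h.
  have [c [r ->]] := T_span h; rewrite mulr_sumr; apply: eq_bigr => w _.
  by rewrite -scalerAr TM ?mul1g ?ell1.
by rewrite -[LHS]mulr1 E.
Qed.

Lemma omegaV g : Omega g -> Omega g^-1%g.
Proof.
move=> /omega_alc og; apply/omega_alc.
by rewrite -[g^-1%g]mulg1 alcM -og -alcM mulVg.
Qed.

Lemma ell_Omega0 g : Omega g -> ell g = 0%N.
Proof. by move=> og; rewrite -[g]mul1g (ell_omega _ og) ell1. Qed.

Lemma T_omega v g : Omega g -> T v * T g = T (v * g)%g.
Proof. by move=> og; apply: TM; rewrite (ell_omega _ og) (ell_Omega0 og) addn0. Qed.

Lemma ell_Sa1 s : Sa s -> ell s = 1%N.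
Proof. by move=> /(ell_Sa 1%g); rewrite mul1g ell1 => -[]. Qed.

Lemma T_up v s : Sa s -> ell (v * s)%g = (ell v).+1 -> T v * T s = T (v * s)%g.
Proof. by move=> ss E; apply: TM; rewrite E (ell_Sa1 ss) addn1. Qed.

Lemma T_down v s : Sa s -> ell v = (ell (v * s)%g).+1 ->
  T v * T s = qs d s *: T (v * s)%g + (qs d s - 1) *: T v.
Proof.
move=> ss E; have vE : T v = T (v * s)%g * T s.
  by rewrite T_up // -mulgA (Sa_invol ss) mulg1.
rewrite {1}vE -mulrA (T_quad _ ss) T_one mulrDr -!scalerAr mulr1.
by rewrite -vE.
Qed.

Lemma T_Sa_unit s : Sa s -> T s \is a GRing.unit.
Proof.
move=> ss; have qu : qs d s \is a GRing.unit by exact: qX_unit.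
apply/unitrP; exists ((qs d s)^-1 *: (T s - (qs d s - 1) *: 1)).
have E := T_quad H ss; rewrite T_one in E.
split.
  rewrite -scalerAl mulrBl -scalerAl mul1r E addrK scalerA mulVr // scale1r //.
by rewrite -scalerAr mulrBr -scalerAr mulr1 E addrK scalerA mulVr // scale1r.
Qed.

Lemma T_unit v : T v \is a GRing.unit.
Proof.
have [k] := ubnP (ell v); elim: k v => // k IHk v vk.
have [v0|v0] := eqVneq (ell v) 0%N.
  have og := ell0_omega R v0; have ogV := omegaV og.
  apply/unitrP; exists (T v^-1%g); split.
    by rewrite (T_omega _ og) mulVg T_one.
  by rewrite (T_omega _ ogV) mulgV T_one.
have [s ss vs] := ell_descent R (elimN eqP v0).
have -> : T v = T (v * s)%g * T s.
  by rewrite T_up // -mulgA (Sa_invol ss) mulg1.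
rewrite unitrMl ?(T_Sa_unit ss) //; apply: IHk; move: vk vs; clear; lia.
Qed.

Lemma mem_weyl w : (w \in W) = (w \in weyl D).
Proof. by rewrite in_fset_set //; exact: finite_weyl. Qed.

Lemma weylP w : reflect (weyl D w) (w \in W).
Proof. by rewrite mem_weyl; apply: (iffP idP); rewrite inE. Qed.

Lemma one0E : one0 H = \sum_(w <- W) T w.
Proof. exact/fsbig_finite/finite_weyl. Qed.

Lemma weyl_sum_bij (V : nmodType) (f : wext D -> V) (h k : wext D -> wext D) :
  cancel h k -> cancel k h -> (forall w, weyl D w -> weyl D (h w)) ->
  (forall w, weyl D w -> weyl D (k w)) ->
  \sum_(w <- W) f (h w) = \sum_(w <- W) f w.
Proof.
move=> hk kh hW kW; rewrite -(big_map h xpredT f); apply: perm_big.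
apply: uniq_perm; [by rewrite map_inj_uniq ?fset_uniq //; apply: can_inj hk|exact: fset_uniq|].
move=> w; apply/mapP/idP => [[u /weylP u0 ->]|/weylP w0]; first exact/weylP/hW.
by exists (k w); rewrite ?kh //; apply/weylP/kW.
Qed.

(** Pair w with ws. If ws is the longer, the two terms give T_{ws} and q_s T_w + (q_s - 1) T_{ws},
    in all q_s (T_w + T_{ws}). *)
Lemma one0_reflw i (s := reflw i) : one0 H * T s = qs d s *: one0 H.
Proof.
have ss : Sa s by exact: reflw_Sa.
have s0 : weyl D s by exact: reflw_weyl.
have sK : cancel (fun w : wext D => w * s)%g (fun w => w * s)%g.
  by move=> w; rewrite -mulgA (Sa_invol ss) mulg1.
have sW w : weyl D w -> weyl D (w * s)%g by move=> w0; apply: weylM.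
pose up w := ell (w * s)%g == (ell w).+1.
have ups w : up (w * s)%g = ~~ up w.
  by rewrite /up sK; case: (ell_Sa w ss) => ->; clear; lia.
have E1 : \sum_(w <- W) (if up w then T (w * s)%g else 0) =
          \sum_(w <- W) (if up w then 0 else T w).
  rewrite -[RHS](weyl_sum_bij _ sK sK sW sW); apply: eq_bigr => w _.
  by rewrite ups; case: (up w).
have E2 : \sum_(w <- W) (if up w then 0 else T (w * s)%g) =
          \sum_(w <- W) (if up w then T w else 0).
  rewrite -[RHS](weyl_sum_bij _ sK sK sW sW); apply: eq_bigr => w _.
  by rewrite ups; case: (up w).
rewrite one0E mulr_suml.
transitivity (\sum_(w <- W) (if up w then T (w * s)%g else 0) +
   (qs d s *: (\sum_(w <- W) (if up w then 0 else T (w * s)%g)) +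
   (qs d s - 1) *: \sum_(w <- W) (if up w then 0 else T w))).
  rewrite !scaler_sumr -!big_split; apply: eq_bigr => w _ /=.
  have [uw|nuw] := boolP (up w).
    by rewrite !scaler0 !addr0 T_up //; apply/eqP.
  by rewrite add0r T_down //; case: (ell_Sa w ss) => // E; rewrite /up E eqxx in nuw.
rewrite E1 E2 scalerBl scale1r addrCA [X in _ + X = _]addrC subrK -scalerDr.
by congr (_ *: _); rewrite -big_split; apply: eq_bigr => w _ /=;
  case: (up w); rewrite ?addr0 ?add0r.
Qed.

Lemma one0_weyl w : weyl D w -> one0 H * T w = q ^+ Dw w *: one0 H.
Proof.
have [k] := ubnP (ell w); elim: k w => // k IHk w wk w0.
have [->|/eqP w1] := eqVneq w 1%g.
  by rewrite T_one mulr1 /wlen sepw1 scale1r.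
have [i wi] := weyl_descent R w0 w1.
have ss := reflw_Sa R i.
have s0 := weylM w0 (reflw_weyl i).
have wE : w = (w * reflw i * reflw i)%g by rewrite -mulgA (Sa_invol ss) mulg1.
have up : ell (w * reflw i * reflw i)%g = (ell (w * reflw i)%g).+1 by rewrite -wE.
rewrite {1 2}wE -T_up // mulrA IHk //; last by move: wk wi; clear; lia.
by rewrite -scalerAl one0_reflw scalerA (wlen_Sa hd ss up) exprD.
Qed.

Lemma weyl_stable_hypw : weyl_stable D (@hypw R n D d).
Proof. by move=> a M aR wM; rewrite hypw_opp // hypw_weyl. Qed.

Lemma wlen_weylV w : weyl D w -> Dw w^-1%g = Dw w.
Proof. exact: sepw_weylV weyl_stable_hypw. Qed.

Lemma one0_Tbar w : weyl D w -> one0 H * Tbar H w = (q ^+ Dw w)^-1 *: one0 H.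
Proof.
move=> w0; have := one0_weyl (weylV w0); rewrite wlen_weylV // => E.
apply: (mulIr (T_unit w^-1%g)); rewrite -mulrA mulVr ?T_unit // mulr1.
by rewrite -scalerAl E scalerA mulVr ?qX_unit // scale1r.
Qed.

(** The product T_{w^-1} T_{w w0} has additive lengths and equals T_{w0}, so the sum of the [Tbar]
    times T_{w0} is [one0]; then cancel T_{w0}, which acts on [one0] by q_{w0}. *)
Lemma one0_sum_Tbar w0 : weyl D w0 -> neg_all w0 ->
  one0 H = q ^+ Dw w0 *: \sum_(w <- W) Tbar H w.
Proof.
move=> w00 neg; have B : one0 H = (\sum_(w <- W) Tbar H w) * T w0.
  rewrite mulr_suml one0E -(@weyl_sum_bij _ T (fun w => w * w0)%g (fun w => w * w0^-1)%g).
  - apply: eq_big_seq => w /weylP wW.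
    have L : ell (w^-1 * (w * w0))%g = (ell w^-1%g + ell (w * w0)%g)%N.
      have E := sepw_longest (@weyl_stable1 n D) (weylV wW) (weylV w00) (neg_allV neg).
      rewrite mulKg -(ell_weylV w00) -(ell_weylV (weylM wW w00)) invgM.
      by rewrite -[LHS]E addnC.
    by apply: (mulrI (T_unit w^-1%g)); rewrite mulrA mulrV ?T_unit // mul1r TM // mulKg.
  - exact: mulgK.
  - exact: mulgVK.
  - by move=> w wW; apply: weylM.
  - by move=> w wW; apply: weylM (weylV w00).
apply: (mulIr (T_unit w0)); rewrite -scalerAl -B; exact: one0_weyl.
Qed.

Lemma qdomD x y : dominant D x -> dominant D y ->
  qdom R d (x + y) = qdom R d x * qdom R d y.
Proof.
move=> dx dy; rewrite !(qdomE hd) -exprD; congr (_ ^+ _).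
by rewrite -translM (wlen_mul hd) // translM ell_transl.
Qed.

Lemma qdom_unit x : qdom R d x \is a GRing.unit.
Proof. by rewrite (qdomE hd) unitrX // qhalf_unit. Qed.

Lemma qdom_sqr x : qdom R d x * qdom R d x = q ^+ Dw (transl D x).
Proof. by rewrite (qdomE hd) -exprMn. Qed.

Lemma dominant0 : dominant D 0.
Proof. by move=> a _; rewrite pairZ0r. Qed.

Lemma dom_splitP x y z : dominant D y -> dominant D z -> x = y - z ->
  [/\ dominant D (dom_split D x).1, dominant D (dom_split D x).2 &
      x = (dom_split D x).1 - (dom_split D x).2].
Proof.
move=> dy dz xE; rewrite /dom_split; case: xgetP => [p _ //|/(_ (y, z))[]].
by split.
Qed.

(** [dom_split] may return any two dominant coweights of difference x; additivity of lengths on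
    dominant translations makes the choice cancel. *)
Lemma qwt_dominant x : dominant D x -> qwt R d x = qdom R d x.
Proof.
move=> dx; have [d1 d2 xE] := dom_splitP dx dominant0 (esym (subr0 x)).
by rewrite /qwt -[X in qdom R d X / _](subrK (dom_split D x).2) -xE qdomD // mulrK // qdom_unit.
Qed.

Lemma qwt_opp_dominant x : dominant D x -> qwt R d (- x) = (qdom R d x)^-1.
Proof.
move=> dx; have [d1 d2 xE] := dom_splitP dominant0 dx (esym (sub0r x)).
have E : (dom_split D (- x)).2 = x + (dom_split D (- x)).1.
  by rewrite -[X in X + _]opprK {2}xE opprB subrK.
by rewrite /qwt E qdomD // invrM ?qdom_unit // mulrA mulrV ?qdom_unit // mul1r.
Qed.

Lemma Xwt_dominant x : dominant D x -> Xwt H x = (qdom R d x)^-1 *: T (transl D x).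
Proof.
move=> dx; have [d1 d2 xE] := dom_splitP dx dominant0 (esym (subr0 x)).
rewrite /Xwt qwt_dominant //; congr (_ *: _).
rewrite -[X in T (transl D X) / _](subrK (dom_split D x).2) -xE -translM.
by rewrite -TM ?mulrK ?T_unit // translM ell_transl.
Qed.

Lemma T_transl_Tbar x w : weyl D w -> dominantv (transl D x * w)%g ->
  T (transl D x) * Tbar H w = T (transl D x * w)%g.
Proof.
move=> w0 dom; apply: (mulIr (T_unit w^-1%g)).
rewrite -mulrA mulVr ?T_unit // mulr1 TM mulgK // (ell_weylV w0).
exact: ell_dominantv.
Qed.

Lemma wlen_dominantv x w : weyl D w -> dominantv (transl D x * w)%g ->
  Dw (transl D x) = (Dw (transl D x * w)%g + Dw w)%N.
Proof.
move=> w0 dom; rewrite -[in RHS](wlen_weylV w0) -(wlen_mul hd) mulgK // (ell_weylV w0).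
exact: ell_dominantv.
Qed.

Lemma dominantv_dominant x w : weyl D w -> dominantv (transl D x * w)%g -> dominant D x.
Proof. by move=> w0 dom a ap; have := dom a ap; rewrite vfloor_transl //; clear; lia. Qed.

(* In the dominant chamber l(tau_x) = l(tau_x w) + l(w), which turns X_A into a
   multiple of a standard basis element. *)
Lemma Xgalc_dominantv v : dominantv v ->
  Xgalc H (galc_of R v) = (q ^+ Dw v)^-1 *: T v.
Proof.
move=> dom; have vE := transl_linpart v; have w0 := linpart_weyl v.
set x := (val v).1 in vE; set w := linpart v in vE w0.
rewrite -vE in dom *; have dx := dominantv_dominant w0 dom.
rewrite /Xgalc wt_galc delta_galc linpart_transl // transl_mulE //=.
rewrite qwt_opp_dominant // Xwt_dominant // -scalerAl T_transl_Tbar // scalerA.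
congr (_ *: _); rewrite (qwE hd) mulrAC -invrM ?qdom_unit // qdom_sqr.
rewrite (wlen_dominantv w0 dom) exprD invrM ?qX_unit // mulrC mulrA.
by rewrite mulrV ?qX_unit // mul1r.
Qed.

End Hecke.

(** * Minimal types and the main formula *)

Section MinimalType.
Variables (R : realType) (n : nat) (D : rootDatum n).
Implicit Types (v w u s g : wext D) (t : seq (wext D)).
Local Notation Sa := (Defs.Sa R).
Local Notation Omega := (Defs.Omega R).
Local Notation galc_of := (@galc_of R n D).

Definition letters t := count (fun u => `[< Sa u >]) t.

Lemma gtype_cons u t : gtype R (u :: t) -> (Sa u \/ Omega u) /\ gtype R t.
Proof.
move=> tg; split; first by apply: tg; rewrite mem_head.
by move=> s st; apply: tg; rewrite inE st orbT.
Qed.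

Lemma ell_type v t : gtype R t ->
  (ell (v * \prod_(u <- t) u)%g <= ell v + letters t)%N /\
  odd (ell (v * \prod_(u <- t) u)%g) = odd (ell v + letters t).
Proof.
elim: t v => [|u t IHt] v tg; first by rewrite big_nil mulg1 addn0.
have [uSO tg'] := gtype_cons tg; have [le od] := IHt (v * u)%g tg'.
rewrite big_cons mulgA /=; case: asboolP => [su|nsu] /=; last first.
  have ou : Omega u by case: uSO.
  by rewrite add0n; rewrite (ell_omega v ou) in le od.
rewrite add1n addnS; have [E|E] := ell_Sa v su.
  by rewrite -addSn -E.
rewrite E addSn od /= negbK; split=> //.
by apply: leq_trans le _; clear; lia.
Qed.

Fixpoint straight v t : seq (galc R n) :=
  galc_of v :: (if t is u :: t' then straight (v * u)%g t' else [::]).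

Lemma straight_gallery v t : gallery t (straight v t) /\
  end_ D (straight v t) = galc_of (v * \prod_(u <- t) u)%g.
Proof.
elim: t v => [|u t IHt] v.
  rewrite big_nil mulg1; split=> //; split=> // A; rewrite inE => /eqP->.
  exact: galcoves_galc.
have [[sz gal st] e] := IHt (v * u)%g; rewrite big_cons mulgA -e; split; last first.
  by rewrite /end_ /= sz /=.
split=> [|A|i]; first by rewrite /= sz.
  by rewrite inE => /predU1P[->|/gal//]; apply: galcoves_galc.
case: i => [|i]; last by rewrite ltnS => it; exact: (st i it).
have E : ith D (straight v (u :: t)) 1 = galc_of (v * u)%g by case: (t).
have E0 : ith D (straight v (u :: t)) 0 = galc_of v by [].
by move=> _ u'; rewrite E E0 ract_galc; split; [|right].
Qed.

(** Deleting the folded letters leaves the type of an unfolded gallery with the same ends; if no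
    letter is lost, there was no fold. *)
Lemma gallery_type v w t sigma : gtype R t -> gallery t sigma ->
  ith D sigma 0 = galc_of v -> end_ D sigma = galc_of w ->
  exists t', [/\ gtype R t', (size t' <= size t)%N, w = (v * \prod_(u <- t') u)%g &
                 size t' = size t -> t' = t].
Proof.
elim: t v sigma => [|u t IHt] v sigma tg.
  case=> sz _ _; case: sigma sz => [//|A [|//]] _.
  rewrite -[end_ D _]/A ith0 => -> /galc_of_inj ->.
  by exists [::]; rewrite big_nil mulg1.
have [uSO tg'] := gtype_cons tg.
case=> sz gal st; case: sigma sz gal st => [//|A sigma] [sz] gal st.
rewrite ith0 => AE; rewrite /end_ /= sz ithS => e.
have [stO stS] := st 0%N isT; rewrite ithS ith0 AE ract_galc in stO stS.
have gal' : gallery t sigma.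
  split=> // [B Bs|i it]; first by apply: gal; rewrite inE Bs orbT.
  exact: (st i.+1 it).
have e' : end_ D sigma = galc_of w by rewrite /end_ sz.
have keep : ith D sigma 0 = galc_of (v * u)%g ->
    exists t', [/\ gtype R t', (size t' <= size (u :: t))%N,
      w = (v * \prod_(u <- t') u)%g & size t' = size (u :: t) -> t' = u :: t].
  move=> E; have [t' [tg1 sz1 wE tE]] := IHt _ _ tg' gal' E e'.
  exists (u :: t'); rewrite big_cons mulgA; split=> //.
    by move=> s; rewrite inE => /predU1P[->|/tg1].
  by move=> [/tE->].
case: uSO => [su|/stO/keep//]; have [E|/keep//] := stS su.
have [t' [tg1 sz1 wE tE]] := IHt _ _ tg' gal' E e'.
exists t'; split=> //; first exact: leqW.
by move=> szE; move: sz1; rewrite szE /= ltnn.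
Qed.

(** The size of a type also counts letters in Omega. A reduced word followed by its element of Omega
    bounds it by [ell v] + 1, and parity rules out one letter of S^a too many. *)
Lemma minimal_typeP v t : minimal_type R v t ->
  [/\ gtype R t, v = (\prod_(u <- t) u)%g & letters t = ell v].
Proof.
move=> [sigma [[tg [gal min]] h0 e]].
have min' t' : gtype R t' -> v = (\prod_(u <- t') u)%g -> (size t <= size t')%N.
  move=> tg' vE; have [g' e'] := straight_gallery 1%g t'.
  apply: (min t' (straight 1%g t') tg' g'); first by rewrite h0; case: (t').
  by rewrite e e' mul1g -vE.
have [t' [tg' sz' vE tE]] := gallery_type tg gal h0 e.
rewrite mul1g in vE.
have tt' : t' = t by apply/tE/eqP; rewrite eqn_leq sz' min'.
rewrite tt' in vE; split=> //.
have [ts [tsS [g og vE']] tsz] := word_exists R v.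
have sz : (size t <= (ell v).+1)%N.
  rewrite -tsz -(size_rcons ts g); apply: min'.
    move=> u; rewrite mem_rcons inE => /predU1P[->|/tsS su]; [by right|by left].
  by rewrite vE' -cats1 big_cat big_seq1.
have [le od] := ell_type 1%g tg; rewrite mul1g -vE ell1 !add0n in le od.
have := count_size (fun u => `[< Sa u >]) t; rewrite -/(letters t).
move: sz le od; rewrite -[size t]/(size t); move: (letters t) (ell v) (size t) => a b c.
move=> h1 h2 h3 h4; have [ab|] : a = b \/ a = b.+1 by move: h1 h2 h4; clear; lia.
  by [].
by move=> E; move: h3; rewrite E /=; case: (odd b).
Qed.

Variables (d : wext D -> nat) (H : heckeAlgebra R d).

Lemma T_type v t : gtype R t ->
  ell (v * \prod_(u <- t) u)%g = (ell v + letters t)%N ->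
  T H (v * \prod_(u <- t) u)%g = T H v * \prod_(u <- t) T H u.
Proof.
elim: t v => [|u t IHt] v tg; first by rewrite !big_nil mulg1 mulr1.
have [uSO tg'] := gtype_cons tg; have [le _] := ell_type (v * u)%g tg'.
rewrite !big_cons !mulgA mulrA /=; case: asboolP => [su|nsu] /=; last first.
  have ou : Omega u by case: uSO.
  by rewrite add0n => E; rewrite IHt // ?(T_omega _ _ ou) // (ell_omega _ ou).
rewrite add1n addnS => E.
have up : ell (v * u)%g = (ell v).+1.
  by have := ell_Sa v su; rewrite E in le; move: le; clear; lia.
by rewrite IHt // ?T_up // E up addSn.
Qed.

End MinimalType.

(** * From one multiplication to the sum over galleries *)

Section Main.
Variables (R : realType) (n : nat) (D : rootDatum n).
Variables (d : wext D -> nat) (hd : conj_invariant R d) (H : heckeAlgebra R d).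
Implicit Types (v w u s g : wext D) (x : 'cV[int]_n) (t : seq (wext D)).
Local Notation Sa := (Defs.Sa R).
Local Notation Omega := (Defs.Omega R).
Local Notation Dw := (wlen R d).
Local Notation T := (T H).
Local Notation W := (fset_set (weyl D)).
Local Notation galc_of := (@galc_of R n D).

Lemma one0X_omega v g : Omega g -> dominantv v ->
  one0 H * Xgalc H (galc_of v) * T g = one0 H * Xgalc H (galc_of (v * g)%g).
Proof.
move=> og dom; have dvg := dominantv_omega og dom.
rewrite !(Xgalc_dominantv hd) // -mulrA -scalerAl (T_omega _ _ og).
by rewrite /wlen (sepw_omega _ _ og).
Qed.

Lemma invqX_split k m : (q ^+ k)^-1 = q ^+ m * (q ^+ (k + m))^-1.
Proof. by rewrite exprD invrM ?qX_unit // mulrA mulrV ?qX_unit // mul1r. Qed.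

(* When v s leaves the chamber, v s = s_i v and T_v T_s = T_{s_i} T_v, and the
   factor T_{s_i} is absorbed by one0. *)
Lemma one0X_out v s i : Sa s -> dominantv v -> ell (v * s)%g = (ell v).+1 ->
  (v * s)%g = (reflw i * v)%g ->
  one0 H * Xgalc H (galc_of v) * T s = qs d s *: (one0 H * Xgalc H (galc_of v)).
Proof.
move=> ss dom up E; rewrite (Xgalc_dominantv hd) // -!scalerAr -scalerAl.
rewrite -mulrA (T_up _ ss up) E -TM; last first.
  by rewrite -E up (ell_Sa1 (reflw_Sa R i)).
rewrite mulrA (one0_reflw _ i) -scalerAl !scalerA mulrC; congr (_ * _ *: _).
congr (q ^+ _); apply: (hd (v := v) ss (reflw_Sa R i)).
by rewrite E mulgK.
Qed.

Lemma one0X_up v s : Sa s -> dominantv v -> dominantv (v * s)%g ->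
  ell (v * s)%g = (ell v).+1 ->
  one0 H * Xgalc H (galc_of v) * T s = qs d s *: (one0 H * Xgalc H (galc_of (v * s)%g)).
Proof.
move=> ss dom dvs up; rewrite !(Xgalc_dominantv hd) // -!scalerAr -scalerAl.
rewrite -mulrA (T_up _ ss up) scalerA; congr (_ *: _).
by rewrite (wlen_Sa hd ss up) (invqX_split _ (d s)).
Qed.

Lemma one0X_down v s : Sa s -> dominantv v -> dominantv (v * s)%g ->
  ell v = (ell (v * s)%g).+1 ->
  one0 H * Xgalc H (galc_of v) * T s =
  one0 H * Xgalc H (galc_of (v * s)%g) + (qs d s - 1) *: (one0 H * Xgalc H (galc_of v)).
Proof.
move=> ss dom dvs down; rewrite !(Xgalc_dominantv hd) // -!scalerAr -scalerAl.
rewrite -mulrA (T_down _ ss down) mulrDr -!scalerAr scalerDr !scalerA.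
congr (_ *: _ + _ *: _); last by rewrite mulrC.
have up : ell (v * s * s)%g = (ell (v * s)%g).+1.
  by rewrite -down -mulgA (Sa_invol ss) mulg1.
have := wlen_Sa hd ss up; rewrite -mulgA (Sa_invol ss) mulg1 => ->.
by rewrite (invqX_split (wlen R d (v * s)%g) (d s)) mulrC.
Qed.

Lemma dpaths_head t v sigma : sigma \in dpaths R t v ->
  exists sigma', sigma = galc_of v :: sigma'.
Proof.
by case: t => [|u t] /=; [rewrite inE => /eqP->; exists [::]|case/mapP=> s _ ->; exists s].
Qed.

Lemma end_cons t v A sigma : sigma \in dpaths R t v ->
  end_ D (A :: sigma) = end_ D sigma.
Proof. by move=> /dpaths_head[s ->]. Qed.

Lemma dpaths_sum_cons u t v w :
  \sum_(sigma <- dpaths R t w) Cgal d (u :: t) (galc_of v :: sigma) *: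
     (one0 H * Xgalc H (end_ D (galc_of v :: sigma))) =
  (if `[< Sa u >] then step_weight R d u v w else 1) *:
  \sum_(sigma <- dpaths R t w) Cgal d t sigma *: (one0 H * Xgalc H (end_ D sigma)).
Proof.
rewrite scaler_sumr; apply: eq_big_seq => sigma sp.
rewrite (end_cons _ sp) scalerA; congr (_ *: _).
by have [s sE] := dpaths_head sp; apply: Cgal_cons; rewrite sE.
Qed.

Lemma one0X_galleries t v : gtype R t -> dominantv v ->
  one0 H * Xgalc H (galc_of v) * \prod_(u <- t) T u =
  \sum_(sigma <- dpaths R t v) Cgal d t sigma *: (one0 H * Xgalc H (end_ D sigma)).
Proof.
elim: t v => [|u t IHt] v tg dom.
  by rewrite big_nil big_seq1 mulr1 Cgal_nil scale1r.
have [uSO tg'] := gtype_cons tg.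
rewrite big_cons mulrA /= big_map; case: asboolP => [ou|nou].
  rewrite dpaths_sum_cons; case: asboolP => [su|_]; first by case: (Sa_neq_omega su ou).
  by rewrite (one0X_omega ou dom) IHt ?scale1r //; apply: dominantv_omega ou dom.
have su : Sa u by case: uSO.
have nvu : v <> (v * u)%g.
  by move=> E; have := ell_Sa v su; rewrite -E; clear; lia.
(* A crossing and a fold end at different alcoves, so at most one indicator in [step_weight]
   survives in each case. *)
have ne P : `[< (v * u)%g = v /\ P >] = false by apply: asboolF => -[/esym].
have ne' P : `[< v = (v * u)%g /\ P >] = false by apply: asboolF => -[].
rewrite big_cat /=.
have [pr dvu up|npr dvu down nc|i npr ndvu up vs c] := dominant_step dom su.
- rewrite (asboolT pr) (asboolT dvu) big_nil addr0 dpaths_sum_cons (asboolT su).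
  rewrite -IHt // one0X_up // -scalerAl; congr (_ *: _).
  by rewrite /step_weight (asboolT (conj erefl pr)) !ne expr1 mulr1.
- rewrite (asboolT dvu) (asboolF npr) (dpaths_sum_cons u t v (v * u)%g).
  rewrite (dpaths_sum_cons u t v v) (asboolT su).
  rewrite -!IHt // one0X_down // mulrDl -scalerAl; congr (_ + _ *: _).
    rewrite -[LHS]scale1r; congr (_ *: _).
    by rewrite /step_weight !ne asboolF ?mulr1 // => -[].
  by rewrite /step_weight ne' (asboolT (conj erefl nc)) asboolF ?mul1r ?expr1 // => -[].
- rewrite (asboolF ndvu) (asboolF npr) big_nil add0r dpaths_sum_cons (asboolT su).
  rewrite -IHt // (one0X_out su dom up vs) -scalerAl; congr (_ *: _).
  rewrite /step_weight ne' (asboolT (conj erefl c)).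
  by rewrite asboolF ?expr1 ?mulr1 // => -[].
Qed.

Lemma finite_stab x : finite_set (stab D x).
Proof. by apply: (@sub_finite_set _ _ (weyl D)) => [w []|] //; apply: (finite_weyl R). Qed.

(** For dominant x, these represent the cosets W_x w; they are the possible initial directions of
    galleries in [Gamma_d] of initial weight x. *)
Definition domreps x := [seq w <- W | `[< dominantv (transl D x * w)%g >]].

Lemma domrepsP x w : reflect (weyl D w /\ dominantv (transl D x * w)%g) (w \in domreps x).
Proof.
rewrite mem_filter; apply: (iffP andP) => [[/asboolP dw /(weylP R) w0]//|[w0 dw]].
by split; [apply/asboolP|apply/(weylP R)].
Qed.

Lemma stabV x u : stab D x u -> stab D x u^-1%g.
Proof.
move=> [u0 ux]; split; first exact: weylV.
have [uu _] := weylmx_inv (wextP u).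
move: ux; rewrite /actZ u0 add0r /= u0 mulmx0 oppr0 add0r => {1}<-.
by rewrite mulKmx.
Qed.

Lemma stabP x u : reflect (stab D x u) (u \in fset_set (stab D x)).
Proof. by rewrite in_fset_set; [apply: (iffP idP); rewrite inE|exact: finite_stab]. Qed.

Lemma weyl_perm x : dominant D x ->
  perm_eq W [seq (u * w)%g | u <- fset_set (stab D x), w <- domreps x].
Proof.
move=> dx; apply: uniq_perm; first exact: fset_uniq.
  apply: allpairs_uniq; [exact: fset_uniq|exact/filter_uniq/fset_uniq|].
  move=> [u w] [u' w'] /allpairsP[[a b] /= [/stabP ua /domrepsP[b0 bd] [-> ->]]].
  move=> /allpairsP[[a' b'] /= [/stabP ua' /domrepsP[b0' bd'] [-> ->]]] /= E.
  have bE : b' = (a'^-1 * a * b)%g by rewrite -mulgA E mulKg.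
  have aa : (a'^-1 * a)%g = 1%g.
    by apply: (dominantv_inj R (stabM (stabV ua') ua) b0 bd); rewrite -bE.
  by rewrite bE aa mul1g -[a](mulVKg a') aa mulg1.
move=> w; apply/(weylP R)/allpairsP => [w0|[[u v] /= [/stabP[u0 _] /domrepsP[v0 _] ->]]].
  have [u [v [ux v0 dv ->]]] := stab_dominantv_exists R dx w0.
  by exists (u, v); split=> //=; [apply/stabP|apply/domrepsP].
exact: weylM.
Qed.

(** Lengths add in u w, so its [Tbar] factors; that of u commutes with T_{tau_x}, because u fixes x,
    and reaches [one0], which absorbs it as a scalar. *)
Lemma one0_T_Tbar x u w : dominant D x -> stab D x u -> weyl D w ->
  dominantv (transl D x * w)%g ->
  one0 H * T (transl D x) * Tbar H (u * w)%g =
  (q ^+ Dw u)^-1 *: (one0 H * T (transl D x * w)%g).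
Proof.
move=> dx ux w0 dw; have [u0 _] := ux; have uV := stabV ux.
have uw0 := weylM u0 w0.
have -> : Tbar H (u * w)%g = Tbar H u * Tbar H w.
  rewrite /Tbar invgM -invrM ?T_unit // TM //.
  rewrite -invgM !ell_weylV // (ell_stab_dominantv dx ux w0 dw) addnC //.
have cm : T (transl D x) * Tbar H u = Tbar H u * T (transl D x).
  rewrite /Tbar; apply: (mulrI (T_unit H u^-1%g)); apply: (mulIr (T_unit H u^-1%g)).
  rewrite -!mulrA mulVr ?T_unit // mulr1 !mulrA mulrV ?T_unit // mul1r.
  have L := ell_stab_transl dx uV.
  rewrite !TM // (stab_transl uV) // addnC //.
by rewrite mulrA -[_ * Tbar H u]mulrA cm mulrA (one0_Tbar hd) // -!scalerAl -mulrA T_transl_Tbar.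
Qed.

Lemma one0_Xwt_one0 x w0 : dominant D x -> weyl D w0 -> neg_all w0 ->
  one0 H * Xwt H x * one0 H =
  (qwt R d x * stab_poly R d x) *:
    \sum_(w <- domreps x) q ^+ Dw (w0 * w)%g *: (one0 H * Xgalc H (galc_of (transl D x * w)%g)).
Proof.
move=> dx w00 neg; rewrite (Xwt_dominant hd) // -scalerAr -scalerAl.
rewrite {2}(one0_sum_Tbar hd H w00 neg) -scalerAr mulr_sumr.
rewrite (perm_big _ (weyl_perm dx)) big_allpairs_dep /=.
have -> : stab_poly R d x = \sum_(u <- fset_set (stab D x)) (q ^+ Dw u)^-1.
  rewrite /stab_poly fsbig_finite /=; last exact: finite_stab.
  by apply: eq_bigr => u _; rewrite (qwE hd).
rewrite mulr_sumr scaler_suml !scaler_sumr; apply: eq_big_seq => u /stabP ux.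
rewrite !scaler_sumr; apply: eq_big_seq => w /domrepsP[wW dw].
rewrite (one0_T_Tbar dx ux wW dw) (Xgalc_dominantv hd H dw) -scalerAr !scalerA.
congr (_ *: _); rewrite (qwt_dominant hd dx).
(* With v = tau_x w, the identities q_{w0} = q_{w0 w} q_w and q_x^2 = q_v q_w turn q_{w0} T_v into
   q_x^2 q_{w0 w} X_{A_v}. *)
have E : Dw w0 = (Dw (w0 * w)%g + Dw w)%N.
  exact: (esym (sepw_longest (@weyl_stable_hypw R n D d) wW w00 neg)).
have QE := qdom_sqr hd x; rewrite (wlen_dominantv hd wW dw) in QE.
have qu := qdom_unit hd x.
rewrite E; apply: (mulrI qu); rewrite !mulrA mulrV // mul1r QE !exprD.
set a := q ^+ Dw (w0 * w)%g; set b := q ^+ Dw w; set c := (q ^+ Dw u)^-1.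
set e := q ^+ Dw _; have ee : e \is a GRing.unit by exact: qX_unit.
have : e * e^-1 = 1 by rewrite mulrV.
by move: (e^-1) => f ef; rewrite -[LHS]mul1r -ef; ring.
Qed.

Lemma Gamma_dE t x sigma : gtype R t -> dominant D x ->
  Gamma_d D t x sigma <->
  exists2 w, w \in domreps x & sigma \in dpaths R t (transl D x * w)%g.
Proof.
move=> tg dx; split=> [[gal pf wtx ch]|[w /domrepsP[w0 dw] /dpathsP-/(_ tg dw)]].
  have s0 : ith D sigma 0 \in sigma.
    by case: gal => sz _ _; case: (sigma) sz => // A s _; apply: mem_head.
  have [_ gc _] := gal; have [v vE] := galcovesP (gc _ s0).
  have vx : (val v).1 = x by rewrite -wtx vE wt_galc.
  have vl := transl_linpart v; rewrite vx in vl.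
  have dg : dgallery v t sigma by [].
  have dv := dgallery_dominantv dg.
  exists (linpart v); first by apply/domrepsP; rewrite vl; split=> //; apply: linpart_weyl.
  by rewrite vl; apply/dpathsP.
by case=> gal pf ch h0; split=> //; rewrite h0 wt_galc transl_mulE.
Qed.

Lemma Gamma_d_sum (V : nmodType) (F : seq (galc R n) -> V) t x :
  gtype R t -> dominant D x ->
  \sum_(sigma \in Gamma_d D t x) F sigma =
  \sum_(w <- domreps x) \sum_(sigma <- dpaths R t (transl D x * w)%g) F sigma.
Proof.
move=> tg dx.
pose L := [seq sigma | w <- domreps x, sigma <- dpaths R t (transl D x * w)%g].
have -> : Gamma_d D t x = [set` L].
  apply/seteqP; split=> sigma.
    move=> /(Gamma_dE _ tg dx)[w ww sp]; apply/allpairsPdep; exists w, sigma; split=> //.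
  move=> /allpairsPdep[w [s [ww sp ->]]]; apply/(Gamma_dE _ tg dx); by exists w.
rewrite -fsbig_seq; last first.
  apply: allpairs_uniq_dep.
  - exact/filter_uniq/fset_uniq.
  - by move=> w /domrepsP[_ dw]; apply: dpaths_uniq.
  - move=> [w s] [w' s'] /allpairsPdep[a [b [/domrepsP[a0 _] bp [-> ->]]]].
    move=> /allpairsPdep[a' [b' [/domrepsP[a0' _] bp' [-> ->]]]] /= E.
    (* The first alcove of a gallery determines the representative it starts from, so no gallery is
       listed twice. *)
    have [r rE] := dpaths_head bp; have [r' rE'] := dpaths_head bp'.
    have aa : a = a'.
      have : ith D b 0 = ith D b' 0 by rewrite E.
      by rewrite rE rE' !ith0 => /galc_of_inj/mulgI.
    by rewrite aa E.
by rewrite /L big_allpairs_dep.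
Qed.

End Main.

Theorem theorem6p4 (R : realType) (n : nat) (D : rootDatum n)
    (d : wext D -> nat) (hd : conj_invariant R d) (H : heckeAlgebra R d)
    (w0 : wext D) (hw0 : longest R w0)
    (lambda mu : 'cV[int]_n) (hlambda : dominant D lambda) (hmu : dominant D mu)
    (nmu : wext D) (hnmu : min_rep R mu nmu)
    (t : seq (wext D)) (ht : minimal_type R nmu t) :
  one0 H * Xwt H lambda * one0 H * T H nmu =
  (qwt R d lambda * stab_poly R d lambda) *:
    \sum_(sigma \in Gamma_d D t lambda)
      ((qw R d (w0 * initial_dir D sigma)%g * Cgal d t sigma) *:
       (one0 H * Xgalc H (end_ D sigma))).
Proof.
have [tg nE nl] := minimal_typeP ht.
have TE : T H nmu = \prod_(u <- t) T H u.
  have := T_type (v := 1%g) H tg; rewrite mul1g -nE ell1 add0n T_one mul1r.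
  by apply; rewrite nl.
have [w00 _] := hw0; have neg := longest_neg_all hw0.
rewrite (one0_Xwt_one0 hd H hlambda w00 neg) -scalerAl; congr (_ *: _).
rewrite (Gamma_d_sum _ tg hlambda) mulr_suml.
have dP := domrepsP R lambda.
apply: eq_big_seq => w /dP[wW dw].
rewrite TE -scalerAl (one0X_galleries hd H tg dw) scaler_sumr.
apply: eq_big_seq => sigma sp; rewrite scalerA; congr (_ * _ *: _).
have [s sE] := dpaths_head sp.
by rewrite /initial_dir sE ith0 delta_galc linpart_transl // (qwE hd).
Qed.
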